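(* Let $R > \frac12$ be a fixed real number. Then $$\chi(S^n_R) \le (x(R)+o(1))^n \qquad (n\to\infty),$$ i.e. there is a sequence of real numbers $\varepsilon_n\to 0$ (depending on $R$) such that $\chi(S^n_R)\le (x(R)+\varepsilon_n)^n$ for all $n$, where $$x(R) = \begin{cases} \sqrt{5 - \frac{2}{R^2} + 4\sqrt{1-\frac{5R^2-1}{4R^4}}}, & R > \frac{\sqrt 5}{2},\\[4pt] 2R, & \frac12 < R \le \frac{\sqrt5}{2}.\end{cases}$$
   Context: $S^n_R\subset\mathbb{R}^{n+1}$ is the Euclidean sphere of radius $R$ centered at the origin. $\chi(S^n_R)$ is the minimal number of colors needed to color all points of $S^n_R$ in such a way that any two points of $S^n_R$ at Euclidean distance (in $\mathbb{R}^{n+1}$) exactly $1$ have different colors. The quantity $o(1)$ is for fixed $R$ as $n\to\infty$. *)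

(* Defs.v *)
From HB Require Import structures.
From mathcomp Require Import all_boot all_order all_algebra.
From mathcomp Require Import all_classical all_reals all_analysis.

Set Implicit Arguments.
Unset Strict Implicit.
Unset Printing Implicit Defensive.

Import Order.TTheory GRing.Theory Num.Theory.
Import numFieldNormedType.Exports.

Local Open Scope classical_set_scope.
Local Open Scope ring_scope.

(* The library norm `|u| on 'rV[R]_d is the sup norm, hence this definition. *)
Definition euclidean_norm (R : realType) (d : nat) (u : 'rV[R]_d) : R :=
  Num.sqrt (\sum_(i < d) u 0 i ^+ 2).

Definition euclidean_sphere (R : realType) (n : nat) (r : R) :
    set 'rV[R]_n.+1 :=
  [set u | euclidean_norm u = r].
Arguments euclidean_sphere {R} n r.

Definition unit_distance_colorable (R : realType) (d : nat)
    (A : set 'rV[R]_d) (k : nat) : Prop :=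
  exists c : A -> 'I_k, forall u v : A,
    euclidean_norm (set_val u - set_val v) = 1 -> c u <> c v.

(* An extended real so that the value is +oo when no finite number of colors
   suffices; otherwise the infimum, over a nonempty set of natural numbers,
   is a minimum. *)
Definition chromatic_number (R : realType) (d : nat)
    (A : set 'rV[R]_d) : \bar R :=
  ereal_inf [set k%:R%:E | k in unit_distance_colorable A].

(* Only meaningful for 1/2 < r. When r > sqrt 5 / 2 both radicands are
   positive, so Num.sqrt, which is 0 on negative numbers, is the true square
   root there. *)
Definition sphere_coloring_base (R : realType) (r : R) : R :=
  if Num.sqrt 5 / 2 < r then
    Num.sqrt (5 - 2 / r ^+ 2 +
              4 * Num.sqrt (1 - (5 * r ^+ 2 - 1) / (4 * r ^+ 4)))
  else 2 * r.

(* Main.v *)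
Require Import Defs.
From HB Require Import structures.
From mathcomp Require Import all_boot all_order all_algebra.
From mathcomp Require Import all_classical all_reals all_analysis.
From mathcomp Require Import measurable_realfun ring lra.

(** Rescaled to the unit sphere, the forbidden distance is [2 * a] with
    [a = 1 / (2 * r)]. A set that contains no two points at this distance and
    has proportion [p] of the sphere gives a coloring: about [1 / p] isometric
    copies of it, up to a factor polynomial in the dimension, cover the sphere,
    and each copy serves as a color. So it is enough to find such sets with [p]
    at least a constant times [l ^+ n], for every [l] below [1 / x], where [x]
    is [sphere_coloring_base r].

    The set. Take on the sphere a maximal set [X] of points forming pairwise
    angles at least [2 alpha], so that the Voronoi cells of [X] have angular
    radius at most [2 alpha]. Compress each cell towards its centre, multiplying
    the distances to the axis of the centre by [l]. If [l * sin (2 alpha)]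
    is below [a], a compressed cell lies in a cap of diameter less than [2 * a].
    The compression also moves the cells away from the hyperplanes that bound
    them. Their distance to these hyperplanes is smallest at the angle [alpha]
    ([shrink_gap_le]), and if it exceeds [a] there, different compressed cells
    are more than [2 * a] apart ([color_class_free]). Choose [phi] and [psi] of
    sines [a] and [2 * a], and [2 alpha = phi + psi]: then both conditions are
    equalities for [l = sin phi / sin (phi + psi)], that is for
    [1 / l = 2 cos phi + cos psi = x], and every smaller [l] leaves a margin
    ([large_sphere_colorable]). At [r = sqrt 5 / 2] the angle [phi + psi]
    becomes right; from there down to [1 / 2] one cap around one point is taken,
    and the only condition is [l < a] ([small_sphere_colorable]).

    The proportion. It is measured by the volume of the cone over the set inside
    the unit ball, so that the compression can be compared with affine maps
    of determinant [k * l ^+ n] for a constant [k] ([measure_axial_map],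
    [shrunk_cells_volume]). Volume is the iterated product of Lebesgue measures
    on the line. An exchange of two integrals ([measure_linear_exchange]) shows
    that a linear bijection multiplies all volumes by one constant, which
    evaluates to one for an isometry, seen on the ball, and to the product of
    the entries for a diagonal matrix, seen on a cube.

    The covering. Instead of an invariant measure on the orthogonal group,
    finite averages of isometric copies of a tent function are used. Comparing
    volumes, such an average is at least [p] somewhere ([exists_deep_point]);
    averaging again over finitely many isometries that bring every point near
    that place raises its minimum ([average_step]), and after finitely many
    steps the average is at least [p / 2] everywhere ([average_min]). A greedy
    choice among the isometries of this average then covers a finite net
    ([greedy_cover]), and a margin in the definition of the set passes from the
    net to the sphere ([covering_by_isometries]).

    Altogether the chromatic number is at most [M * n.+1 ^+ 2 / l ^+ n] for each
    [l < 1 / x], with [M] independent of [n], so that the upper limit of its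
    [n]-th root is at most [x]. *)

Set Implicit Arguments.
Unset Strict Implicit.
Unset Printing Implicit Defensive.

Import Order.TTheory GRing.Theory Num.Theory.
Import numFieldNormedType.Exports.

Local Open Scope classical_set_scope.
Local Open Scope ring_scope.

Local Notation enorm := euclidean_norm.

(** * Euclidean geometry of row vectors *)

Section Dot.
Context {R : realType} {d : nat}.
Implicit Types (u v w : 'rV[R]_d) (h : 'M[R]_d).

Definition dot u v : R := \sum_i u 0 i * v 0 i.

Lemma dotC u v : dot u v = dot v u.
Proof. by apply: eq_bigr => i _; rewrite mulrC. Qed.

Lemma dotDl u v w : dot (u + v) w = dot u w + dot v w.
Proof. by rewrite -big_split; apply: eq_bigr => i _; rewrite !mxE mulrDl. Qed.

Lemma dotZl k u v : dot (k *: u) v = k * dot u v.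
Proof. by rewrite mulr_sumr; apply: eq_bigr => i _; rewrite !mxE mulrA. Qed.

Lemma dotNl u v : dot (- u) v = - dot u v.
Proof. by rewrite -scaleN1r dotZl mulN1r. Qed.

Lemma dotBl u v w : dot (u - v) w = dot u w - dot v w.
Proof. by rewrite dotDl dotNl. Qed.

Lemma dotDr u v w : dot u (v + w) = dot u v + dot u w.
Proof. by rewrite dotC dotDl !(dotC _ u). Qed.

Lemma dotZr k u v : dot u (k *: v) = k * dot u v.
Proof. by rewrite dotC dotZl dotC. Qed.

Lemma dotNr u v : dot u (- v) = - dot u v.
Proof. by rewrite dotC dotNl dotC. Qed.

Lemma dotBr u v w : dot u (v - w) = dot u v - dot u w.
Proof. by rewrite dotDr dotNr. Qed.

Definition dotE := (dotDl, dotBl, dotNl, dotZl, dotDr, dotBr, dotNr, dotZr).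

Lemma dot0l v : dot 0 v = 0.
Proof. by rewrite -(scale0r 0) dotZl mul0r. Qed.

Lemma dot_ge0 u : 0 <= dot u u.
Proof. by apply: sumr_ge0 => i _; rewrite -expr2 sqr_ge0. Qed.

Lemma dot_eq0 u : (dot u u == 0) = (u == 0).
Proof.
apply/idP/eqP => [|->]; last first.
  by rewrite /dot big1 // => i _; rewrite mxE mul0r.
rewrite psumr_eq0 => [/allP /= h|i _]; last by rewrite -expr2 sqr_ge0.
apply/rowP => i; rewrite mxE; apply/eqP.
by have := h i (mem_index_enum _); rewrite -expr2 sqrf_eq0.
Qed.

Lemma enormE u : enorm u = Num.sqrt (dot u u).
Proof. by congr Num.sqrt; apply: eq_bigr => i _; rewrite expr2. Qed.

Lemma enorm_ge0 u : 0 <= enorm u.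
Proof. exact: sqrtr_ge0. Qed.

Lemma sqr_enorm u : enorm u ^+ 2 = dot u u.
Proof. by rewrite enormE sqr_sqrtr // dot_ge0. Qed.

Lemma enorm_eq0 u : (enorm u == 0) = (u == 0).
Proof. by rewrite -sqrf_eq0 sqr_enorm dot_eq0. Qed.

Lemma enorm0 : enorm (0 : 'rV[R]_d) = 0.
Proof. by apply/eqP; rewrite enorm_eq0. Qed.

Lemma enormZ k u : enorm (k *: u) = `|k| * enorm u.
Proof.
by rewrite !enormE !dotE mulrA -expr2 sqrtrM ?sqr_ge0 // sqrtr_sqr.
Qed.

Lemma enormN u : enorm (- u) = enorm u.
Proof. by rewrite -scaleN1r enormZ normrN1 mul1r. Qed.

Lemma enormC u v : enorm (u - v) = enorm (v - u).
Proof. by rewrite -enormN opprB. Qed.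

Lemma cauchy_schwarz u v : dot u v <= enorm u * enorm v.
Proof.
have [->|u0] := eqVneq u 0.
  by rewrite enorm0 mul0r dot0l.
have [->|v0] := eqVneq v 0.
  by rewrite enorm0 mulr0 dotC dot0l.
have nu : 0 < enorm u by rewrite lt_def enorm_eq0 u0 enorm_ge0.
have nv : 0 < enorm v by rewrite lt_def enorm_eq0 v0 enorm_ge0.
have := dot_ge0 (enorm v *: u - enorm u *: v).
rewrite !dotE -!sqr_enorm (dotC v u).
set p := enorm u in nu *; set q := enorm v in nv *; set t := dot u v.
move=> h; rewrite -(ler_pM2l (mulr_gt0 nu nv)); lra.
Qed.

Lemma norm_dot_le u v : `|dot u v| <= enorm u * enorm v.
Proof.
rewrite ler_norml cauchy_schwarz andbT lerNl -dotNl.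
by apply: le_trans (cauchy_schwarz _ _) _; rewrite enormN.
Qed.

Lemma ler_enormD u v : enorm (u + v) <= enorm u + enorm v.
Proof.
rewrite -(@ler_pXn2r _ 2) ?nnegrE ?enorm_ge0 ?addr_ge0 ?enorm_ge0 //.
rewrite sqr_enorm !dotE sqrrD !sqr_enorm (dotC v u).
by have := cauchy_schwarz u v; lra.
Qed.

Lemma ler_enormB u v w : enorm (u - w) <= enorm (u - v) + enorm (v - w).
Proof. by apply: le_trans (ler_enormD _ _); rewrite subrKA. Qed.

Lemma norm_coord_le u i : `|u 0 i| <= enorm u.
Proof.
rewrite -(@ler_pXn2r _ 2) ?nnegrE ?enorm_ge0 // sqr_enorm.
rewrite real_normK ?num_real //.
rewrite /dot (bigD1 i) //= -expr2 lerDl sumr_ge0 // => j _.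
by rewrite -expr2 sqr_ge0.
Qed.

Lemma enorm_le_sum u : enorm u <= \sum_i `|u 0 i|.
Proof.
have s0 : 0 <= \sum_i `|u 0 i| by apply: sumr_ge0.
rewrite -(@ler_pXn2r _ 2) ?nnegrE ?enorm_ge0 // sqr_enorm expr2 mulr_suml.
apply: ler_sum => i _; rewrite -expr2 -real_normK ?num_real // expr2.
apply: ler_wpM2l => //; rewrite (bigD1 i) //= lerDl; exact: sumr_ge0.
Qed.

(** Isometries act on row vectors from the right. *)
Definition isometry_mx h := h *m h^T = 1%:M.

Lemma dot_mulmx u v : dot u v = (u *m v^T) 0 0.
Proof. by rewrite mxE; apply: eq_bigr => i _; rewrite mxE. Qed.

Lemma dot_isometry h u v : isometry_mx h -> dot (u *m h) (v *m h) = dot u v.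
Proof.
by move=> oh; rewrite !dot_mulmx trmx_mul mulmxA -(mulmxA u) oh mulmx1.
Qed.

Lemma enorm_isometry h u : isometry_mx h -> enorm (u *m h) = enorm u.
Proof. by move=> oh; rewrite !enormE dot_isometry. Qed.

Lemma isometry_mx1 : isometry_mx 1%:M.
Proof. by rewrite /isometry_mx trmx1 mulmx1. Qed.

Lemma isometry_mxM h k : isometry_mx h -> isometry_mx k -> isometry_mx (h *m k).
Proof.
by move=> oh ok; rewrite /isometry_mx trmx_mul mulmxA -(mulmxA h) ok mulmx1.
Qed.

Lemma isometry_mxT h : isometry_mx h -> isometry_mx h^T.
Proof. by move=> oh; rewrite /isometry_mx trmxK; apply: mulmx1C. Qed.

Lemma isometry_unitmx h : isometry_mx h -> h \in unitmx.
Proof. by move=> /mulmx1_unit[]. Qed.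

(** The reflection in the bisecting hyperplane of [u] and [v] swaps them. *)
Lemma isometry_transitive u v : enorm u = enorm v ->
  exists2 h, isometry_mx h & u *m h = v.
Proof.
move=> uv; have [<-|ne] := eqVneq u v.
  by exists 1%:M; [exact: isometry_mx1|rewrite mulmx1].
have duv : dot u u = dot v v by rewrite -!sqr_enorm uv.
pose w := u - v; pose q := dot w w.
have q0 : q != 0 by rewrite dot_eq0 subr_eq0.
have ww : w *m w^T = q%:M.
  by apply/matrixP => i j; rewrite !ord1 -dot_mulmx mxE eqxx mulr1n.
exists (1%:M - (2 / q) *: (w^T *m w)).
  rewrite /isometry_mx.
  have -> : (1%:M - (2 / q) *: (w^T *m w))^T = 1%:M - (2 / q) *: (w^T *m w).
    apply/matrixP => i j; rewrite !mxE eq_sym; congr (_ - _ * _).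
    by apply: eq_bigr => k _; rewrite !mxE mulrC.
  set P := w^T *m w.
  have PP : P *m P = q *: P.
    by rewrite mulmxA -(mulmxA _ w) ww mul_mx_scalar -scalemxAl.
  rewrite mulmxBl mul1mx mulmxBr mulmx1 -scalemxAl -scalemxAr PP !scalerA.
  have -> : 2 / q * (2 / q) * q = 2 / q + 2 / q by field.
  by rewrite scalerDl opprB addrK subrK.
rewrite mulmxBr mulmx1 -scalemxAr mulmxA.
have -> : u *m w^T = (q / 2)%:M.
  apply/matrixP => i j; rewrite !ord1 -dot_mulmx mxE eqxx mulr1n.
  rewrite /q /w !dotE (dotC v u) -duv; lra.
rewrite mul_scalar_mx scalerA.
have -> : 2 / q * (q / 2) = 1 by field.
by rewrite scale1r /w subKr.
Qed.

Lemma enorm_delta (i : 'I_d) : enorm (delta_mx 0 i : 'rV[R]_d) = 1.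
Proof.
rewrite enormE /dot (bigD1 i) //= !mxE !eqxx mulr1 big1 => [|j ji].
  by rewrite addr0 sqrtr1.
by rewrite !mxE (negbTE ji) andbF mulr0.
Qed.

End Dot.

(** * Lebesgue measure on row vectors *)

Definition rV_display : measure_display. Proof. exact. Qed.

Section measurable_rV.
Context {R : realType} {n : nat}.

Let coord (i : 'I_n) (v : 'rV[R]_n) : measurableTypeR R := v 0 i.

Let rV_set0 : g_sigma_preimage coord set0.
Proof. exact: sigma_algebra0. Qed.

Let rV_setC A : g_sigma_preimage coord A -> g_sigma_preimage coord (~` A).
Proof. exact: sigma_algebraC. Qed.

Let rV_bigcup (F : (set 'rV[R]_n)^nat) :
  (forall i, g_sigma_preimage coord (F i)) ->
  g_sigma_preimage coord (\bigcup_i (F i)).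
Proof. exact: sigma_algebra_bigcup. Qed.

HB.instance Definition _ := @isMeasurable.Build rV_display
  'rV[R]_n (g_sigma_preimage coord) rV_set0 rV_setC rV_bigcup.

Lemma measurable_coord (i : 'I_n) :
  measurable_fun [set: 'rV[R]_n] (fun v => v 0 i : measurableTypeR R).
Proof.
move=> _ Y mY; rewrite setTI; apply: sub_sigma_algebra => /=.
rewrite -bigcup_seq/=; exists i => /=; first by rewrite mem_index_enum.
by exists Y => //; rewrite setTI.
Qed.

Lemma measurable_fun_rV d (T : measurableType d) (f : T -> 'rV[R]_n) :
  (forall i, measurable_fun setT (fun x => f x 0 i : measurableTypeR R)) ->
  measurable_fun setT f.
Proof.
move=> mf _ Y mY; rewrite setTI.
suff : g_sigma_preimage coord `<=` [set B | measurable (f @^-1` B)] by apply.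
apply: smallest_sub => /=.
  split; rewrite /= ?preimage_set0 //.
  - by move=> A mA; rewrite setTD preimage_setC; exact: measurableC.
  - by move=> F mF; rewrite preimage_bigcup; exact: bigcupT_measurable.
rewrite -bigcup_seq => B [i _] /= [A mA <-].
by have := mf i measurableT A mA; rewrite !setTI.
Qed.

End measurable_rV.

Lemma lebesgue_measure_translation {R : realType} (a : R)
    (A : set (measurableTypeR R)) :
  measurable A ->
  lebesgue_measure ((fun x => a + x) @^-1` A) = lebesgue_measure A.
Proof.
move=> mA; apply/esym.
pose f (x : measurableTypeR R) : measurableTypeR R := a + x.
have mf : measurable_fun setT f by exact: measurable_funD.
apply: (lebesgue_measure_unique (mu := pushforward lebesgue_measure f)) => //.
move=> X [[p q] _ <-] /=.
rewrite /pushforward /f.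
have -> : (fun x => a + x) @^-1` `]p, q] = `]p - a, q - a]%classic.
  by apply/seteqP; split => x /=; rewrite !in_itv /= ltrBlDl lerBrDl.
rewrite !lebesgue_measure_itv /= !lte_fin ltrD2r -!EFinB.
by congr (if _ then _%:E else _); ring.
Qed.

Definition box_formula (R : realType) (n : nat) (mu : set 'rV[R]_n -> \bar R) :=
  forall s : 'I_n -> R, (forall i, 0 <= s i) ->
    mu [set v | forall i, `|v 0 i| <= s i] = (\prod_i (2 * s i))%:E.

Definition translation_invariant (R : realType) (n : nat)
    (mu : set 'rV[R]_n -> \bar R) :=
  forall (a : 'rV[R]_n) (A : set 'rV[R]_n), measurable A ->
    mu ((fun v => a + v) @^-1` A) = mu A.

Lemma measurable_box (R : realType) n (s : 'I_n -> R) :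
  measurable [set v : 'rV[R]_n | forall i, `|v 0 i| <= s i].
Proof.
have -> : [set v : 'rV[R]_n | forall i, `|v 0 i| <= s i] =
    \bigcap_(j in [set: 'I_n]) [set v | `|v 0 j| <= s j].
  by apply/seteqP; split => v /= h j; [move=> _; exact: h|exact: h].
apply: fin_bigcap_measurable => [|j _]; first exact: finite_finset.
have : measurable ([set: 'rV[R]_n] `&`
    (fun v => v 0 j : measurableTypeR R) @^-1` `[- s j, s j]).
  exact: measurable_coord.
rewrite setTI; congr measurable.
by apply/seteqP; split => v /=; rewrite in_itv /= ler_norml.
Qed.

Section volume_succ.
Context {R : realType} {n : nat}.
Variable mu : {sigma_finite_measure set 'rV[R]_n -> \bar R}.

Let lead (p : measurableTypeR R * 'rV[R]_n) : 'rV[R]_n.+1 :=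
  \row_i (if unlift ord0 i is Some j then p.2 0 j else p.1).

Let unlead (v : 'rV[R]_n.+1) : measurableTypeR R * 'rV[R]_n :=
  (v 0 ord0, \row_(j < n) v 0 (lift ord0 j)).

Let lead0 p : lead p 0 ord0 = p.1.
Proof. by rewrite mxE unlift_none. Qed.

Let leadS p j : lead p 0 (lift ord0 j) = p.2 0 j.
Proof. by rewrite mxE liftK. Qed.

Let measurable_lead : measurable_fun setT lead.
Proof.
apply: measurable_fun_rV => i.
case: (unliftP ord0 i) => [j|] ->.
- under eq_fun do rewrite leadS.
  apply: (measurableT_comp
    (f := fun v : 'rV[R]_n => v 0 _ : measurableTypeR R) (g := snd)).
    exact: measurable_coord.
  exact: measurable_snd.
- under eq_fun do rewrite lead0.
  exact: measurable_fst.
Qed.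

Let prodmu : {measure set (measurableTypeR R * 'rV[R]_n)%type -> \bar R} :=
  (@lebesgue_measure R \x mu)%E.

Definition volume_succ (A : set 'rV[R]_n.+1) : \bar R := prodmu (lead @^-1` A).

Let vol0 : volume_succ set0 = 0%E.
Proof. by rewrite /volume_succ preimage_set0 measure0. Qed.

Let vol_ge0 A : (0 <= volume_succ A)%E.
Proof. exact: measure_ge0. Qed.

Let vol_additive : semi_sigma_additive volume_succ.
Proof.
exact: (@measure_semi_sigma_additive _ _ _ (pushforward prodmu lead)).
Qed.

HB.instance Definition _ := isMeasure.Build _ _ _ volume_succ
  vol0 vol_ge0 vol_additive.

Lemma volume_succ_translation :
  translation_invariant mu -> translation_invariant volume_succ.
Proof.
move=> muD a A mA; rewrite /volume_succ.
pose b := unlead a.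
pose sh (p : measurableTypeR R * 'rV[R]_n) : measurableTypeR R * 'rV[R]_n :=
  (b.1 + p.1, b.2 + p.2).
have msh : measurable_fun setT sh.
  apply: measurable_fun_pair.
    by apply: measurable_funD => //; exact: measurable_fst.
  apply: measurable_fun_rV => i; under eq_fun do rewrite mxE.
  apply: measurable_funD => //.
  apply: (measurableT_comp
    (f := fun v : 'rV[R]_n => v 0 _ : measurableTypeR R) (g := snd)).
    exact: measurable_coord.
  exact: measurable_snd.
have -> : lead @^-1` ((fun v => a + v) @^-1` A) = sh @^-1` (lead @^-1` A).
  have e p : a + lead p = lead (sh p).
    apply/rowP => i; case: (unliftP ord0 i) => [j|] ->.
      by rewrite mxE !leadS /= !mxE.
    by rewrite mxE !lead0.
  by apply/seteqP; split => p /=; rewrite e.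
have mA' : measurable (lead @^-1` A).
  by rewrite -[X in measurable X]setTI; exact: measurable_lead.
apply/esym.
apply: (product_measure_unique (m' := pushforward prodmu sh)) => //.
move=> X Y mX mY /=; rewrite /pushforward.
have -> : sh @^-1` (X `*` Y) =
    ((fun x => b.1 + x) @^-1` X) `*` ((fun v => b.2 + v) @^-1` Y).
  by [].
rewrite [LHS]product_measure1E.
- by congr (_ * _)%E; [exact: lebesgue_measure_translation|exact: muD].
- rewrite -[X in measurable X]setTI.
  have : measurable_fun setT
      (fun x : measurableTypeR R => b.1 + x : measurableTypeR R).
    exact: measurable_funD.
  exact.
- rewrite -[X in measurable X]setTI.
  have : measurable_fun setT (fun v : 'rV[R]_n => b.2 + v).
    apply: measurable_fun_rV => i; under eq_fun do rewrite mxE.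
    by apply: measurable_funD => //; exact: measurable_coord.
  exact.
Qed.

Lemma volume_succ_box : box_formula mu -> box_formula volume_succ.
Proof.
move=> muB s s0; rewrite /volume_succ.
have -> : lead @^-1` [set v | forall i, `|v 0 i| <= s i] =
  `[- s ord0, s ord0] `*`
  [set v : 'rV[R]_n | forall j : 'I_n, `|v 0 j| <= s (lift ord0 j)].
  apply/seteqP; split => [p /= h|p /= [h0 hS] i].
    split; first by rewrite in_itv /= -ler_norml -lead0.
    by move=> j; rewrite -leadS.
  case: (unliftP ord0 i) => [j|] ->; first by rewrite leadS.
  by rewrite lead0 ler_norml; move: h0; rewrite in_itv.
rewrite [LHS]product_measure1E //.
- have e : lebesgue_measure `[- s ord0, s ord0] = (2 * s ord0)%:E.
    rewrite lebesgue_measure_itv /= lte_fin.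
    have := s0 ord0; rewrite le_eqVlt => /predU1P[<-|h].
      by rewrite oppr0 ltxx mulr0.
    by rewrite gtrN // -EFinB opprK mulr2n mulrDl mul1r.
  rewrite big_ord_recl EFinM; congr (_ * _)%E; first exact: e.
  by apply: muB.
- exact: measurable_box.
Qed.

End volume_succ.

Lemma box_formula_sigma_finite (R : realType) n
    (mu : {measure set 'rV[R]_n -> \bar R}) : box_formula mu ->
  sigma_finite setT mu.
Proof.
move=> muB; exists (fun k => [set v : 'rV[R]_n | forall i, `|v 0 i| <= k%:R]).
  apply/seteqP; split => // v _.
  exists (Num.bound (\sum_i `|v 0 i|)) => //= i.
  apply/ltW/(le_lt_trans _ (archi_boundP _)); last exact: sumr_ge0.
  by rewrite (bigD1 i) //= lerDl sumr_ge0.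
move=> k; split; first exact: measurable_box.
by rewrite muB // ltry.
Qed.

Section box_measure.
Context {R : realType} {n : nat}.
Implicit Type mu : {measure set 'rV[R]_n -> \bar R}.

(** Carrying the proof of the box formula as an argument lets the measure be
    recognised as sigma-finite. *)
Definition box_measure mu (muB : box_formula mu) : set 'rV[R]_n -> \bar R := mu.

HB.instance Definition _ mu (muB : box_formula mu) :=
  Measure.copy (box_measure muB) mu.

HB.instance Definition _ mu (muB : box_formula mu) :=
  Measure_isSigmaFinite.Build _ _ _ (box_measure muB)
    (box_formula_sigma_finite muB).

End box_measure.

(** The product of [n] copies of the measure on the line. The box formula is
    carried through the induction because it gives sigma-finiteness, on which
    the next product depends. *)
Lemma exists_volume (R : realType) (n : nat) :
  exists mu : {sigma_finite_measure set 'rV[R]_n -> \bar R},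
    translation_invariant mu /\ box_formula mu.
Proof.
suff [mu [muD muB]] : exists mu : {measure set 'rV[R]_n -> \bar R},
    translation_invariant mu /\ box_formula mu by exists (box_measure muB).
elim: n => [|n [mu [muD muB]]].
  exists (dirac (0 : 'rV[R]_0)); split.
    move=> a A mA /=; congr (dirac _ _); apply/seteqP.
    by split=> v /=; rewrite [a + v](_ : _ = v) //; apply/rowP; case.
  move=> s _; rewrite big_ord0.
  transitivity (dirac (0 : 'rV[R]_0) setT : \bar R).
    by congr (dirac _ _); apply/seteqP; split => // v _ [].
  exact: diracT.
exists (volume_succ (box_measure muB)); split.
  exact: volume_succ_translation.
exact: volume_succ_box.
Qed.

(** * Volumes under linear maps *)

Section measurable_vector_maps.
Context {R : realType} {n : nat}.
Implicit Types (f g : 'rV[R]_n -> R).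

Lemma measurable_dotr (x : 'rV[R]_n) : measurable_fun setT (fun v => dot v x).
Proof.
apply: measurable_sum => i; apply: measurable_funM => //.
exact: measurable_coord.
Qed.

Lemma measurable_dot2 : measurable_fun setT (fun v : 'rV[R]_n => dot v v).
Proof.
by apply: measurable_sum => i; apply: measurable_funM => //;
  exact: measurable_coord.
Qed.

Lemma measurable_mulmx (m : nat) (M : 'M[R]_(n, m)) :
  measurable_fun setT (fun v : 'rV[R]_n => v *m M).
Proof.
apply: measurable_fun_rV => i; under eq_fun do rewrite mxE.
apply: measurable_sum => j; apply: measurable_funM => //.
exact: measurable_coord.
Qed.

Lemma measurable_le_set f g : measurable_fun setT f -> measurable_fun setT g ->
  measurable [set v | f v <= g v].
Proof.
move=> mf mg; rewrite -[X in measurable X]setTI.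
have := measurable_fun_ler mf mg measurableT.
by move=> /(_ [set true]); apply.
Qed.

End measurable_vector_maps.

Section linear_maps.
Context {R : realType} {n : nat}.
Variable mu : {sigma_finite_measure set 'rV[R]_n -> \bar R}.
Hypothesis muD : translation_invariant mu.
Local Open Scope ereal_scope.

Lemma integral_sections (E : set ('rV[R]_n * 'rV[R]_n)) : measurable E ->
  \int[mu]_x mu (xsection E x) = \int[mu]_y mu (ysection E y).
Proof.
move=> mE; have := indic_fubini_tonelli mu mu mE.
by rewrite (indic_fubini_tonelli_FE mu mE) (indic_fubini_tonelli_GE mu mE).
Qed.

Lemma integral_cst_on (A : set 'rV[R]_n) (c : \bar R) (f : 'rV[R]_n -> \bar R) :
  measurable A -> 0 <= c ->
  (forall x, A x -> f x = c) -> (forall x, ~ A x -> f x = 0) ->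
  \int[mu]_x f x = mu A * c.
Proof.
move=> mA c0 fA fnA.
rewrite (eq_integral (fun x => (\1_A x)%:E * c)); last first.
  move=> x _; rewrite indicE; have [/set_mem|/negP] := boolP (x \in A).
    by move=> /fA ->; rewrite mul1e.
  by move=> h; rewrite mul0e fnA // => /mem_set.
rewrite ge0_integralZr ?integral_indic ?setIT//; exact: measurableT_comp.
Qed.

(** Both sides integrate the indicator of the pairs [(x, y)] with [x] in [A]
    and [x + y *m M] in [B], one variable after the other; in the second order
    the substitution of [x + y *m M] for [x] exchanges the roles of [A] and
    [B]. *)
Lemma measure_linear_exchange (M : 'M[R]_n) (A B : set 'rV[R]_n) :
  M \in unitmx -> measurable A -> measurable B ->
  mu A * mu [set y | B (y *m M)] = mu B * mu [set y | A (- (y *m M))%R].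
Proof.
move=> uM mA mB.
have mphi : measurable_fun setT (fun y : 'rV[R]_n => y *m M).
  exact: measurable_mulmx.
have mN : measurable_fun setT (fun y : 'rV[R]_n => (- (y *m M))%R).
  have -> : (fun y : 'rV[R]_n => (- (y *m M))%R) = (fun y => y *m (- M)%R).
    by apply/funext => y; rewrite mulmxN.
  exact: measurable_mulmx.
have mpre (f : 'rV[R]_n -> 'rV[R]_n) C : measurable_fun setT f ->
    measurable C -> measurable [set y | C (f y)].
  by move=> mf mC; have := mf measurableT C mC; rewrite setTI.
have mpre2 (f : 'rV[R]_n * 'rV[R]_n -> 'rV[R]_n) C : measurable_fun setT f ->
    measurable C -> measurable [set y | C (f y)].
  by move=> mf mC; have := mf measurableT C mC; rewrite setTI.
have mfst : measurable_fun setT (@fst 'rV[R]_n 'rV[R]_n).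
  exact: measurable_fst.
have mcoord2 M' : measurable_fun setT
    (fun p : 'rV[R]_n * 'rV[R]_n => (p.1 + p.2 *m M')%R).
  apply: measurable_fun_rV => i; under eq_fun do rewrite mxE.
  apply: measurable_funD.
    apply: (measurableT_comp (g := fst)
      (f := fun v : 'rV[R]_n => v 0%R i : measurableTypeR R)).
      exact: measurable_coord.
    exact: measurable_fst.
  apply: (measurableT_comp (g := snd)
    (f := fun v : 'rV[R]_n => (v *m M') 0%R i : measurableTypeR R)).
    apply: (measurableT_comp
      (f := fun v : 'rV[R]_n => v 0%R i : measurableTypeR R)).
      exact: measurable_coord.
    exact: measurable_mulmx.
  exact: measurable_snd.
pose E1 := [set p : 'rV[R]_n * 'rV[R]_n | A p.1 /\ B (p.1 + p.2 *m M)%R].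
pose E2 := [set p : 'rV[R]_n * 'rV[R]_n | A (p.1 + p.2 *m (- M)%R)%R /\ B p.1].
have mE1 : measurable E1.
  apply: measurableI; first exact: (mpre2 fst _ mfst).
  exact: (mpre2 _ _ (mcoord2 M)).
have mE2 : measurable E2.
  apply: measurableI; last exact: (mpre2 fst _ mfst).
  exact: (mpre2 _ _ (mcoord2 (- M)%R)).
transitivity (\int[mu]_x mu (xsection E1 x)).
  apply/esym/integral_cst_on => // x Ax; last first.
    rewrite (_ : xsection _ _ = set0) ?measure0 //.
    by rewrite -subset0 => y /xsectionP [].
  rewrite -(muD (x *m invmx M) (mpre _ _ mphi mB)).
  congr (mu _); apply/seteqP; split => y /=.
    by move=> /xsectionP [_] /=; rewrite mulmxDl mulmxKV.
  by move=> h; apply/xsectionP; split => //=; move: h; rewrite mulmxDl mulmxKV.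
rewrite integral_sections //.
transitivity (\int[mu]_y mu (ysection E2 y)).
  apply: eq_integral => y _.
  rewrite -(muD (y *m M)%R (measurable_ysection y mE2)).
  congr (mu _); apply/seteqP; split => x /=.
    move=> /ysectionP [/= Ax Bx]; apply/ysectionP; split => /=.
      by rewrite mulmxN addrAC subrr add0r.
    by rewrite addrC.
  move=> /ysectionP [/= Ax Bx]; apply/ysectionP; split => /=.
    by move: Ax; rewrite mulmxN addrAC subrr add0r.
  by move: Bx; rewrite addrC.
rewrite -integral_sections //.
apply: integral_cst_on => // x Ax; last first.
  rewrite (_ : xsection _ _ = set0) ?measure0 //.
  by rewrite -subset0 => y /xsectionP [].
rewrite -(muD (- (x *m invmx M))%R (mpre _ _ mN mA)).
congr (mu _); apply/seteqP; split => y /=.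
  move=> /xsectionP [/=].
  by rewrite mulmxDl mulNmx mulmxKV // opprD opprK mulmxN.
move=> h; apply/xsectionP; split => //=.
by move: h; rewrite mulmxDl mulNmx mulmxKV // opprD opprK mulmxN.
Qed.

End linear_maps.

Definition unit_ball (R : realType) (d : nat) : set 'rV[R]_d :=
  [set v | dot v v <= 1].
Arguments unit_ball {R d}.

Section volume.
Context {R : realType} {d : nat}.
Variable mu : {sigma_finite_measure set 'rV[R]_d -> \bar R}.
Hypotheses (muD : translation_invariant mu) (muB : box_formula mu).

Lemma measurable_unit_ball : measurable (@unit_ball R d).
Proof. exact: (measurable_le_set measurable_dot2 (measurable_cst _)). Qed.

Lemma measurable_preim_mulmx (M : 'M[R]_d) (B : set 'rV[R]_d) :
  measurable B -> measurable [set y | B (y *m M)].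
Proof.
by move=> mB; have := measurable_mulmx M measurableT mB; rewrite setTI.
Qed.

Lemma unit_ball_fin_num : mu unit_ball \is a fin_num.
Proof.
rewrite ge0_fin_numE ?measure_ge0 //.
have m1 := @measurable_box R d (fun=> 1).
apply: le_lt_trans (_ : (mu [set v | forall i, (`|v 0 i| <= 1)%R] < +oo)%E).
  apply: le_measure; rewrite ?inE //; first exact: measurable_unit_ball.
  move=> v /= v1 i; apply: le_trans (norm_coord_le v i) _.
  by rewrite enormE -sqrtr1 ler_sqrt.
by rewrite muB ?ltry.
Qed.

Lemma unit_ball_gt0 : (0 < mu unit_ball)%E.
Proof.
have e0 : 0 < (d.+1%:R : R)^-1 by rewrite invr_gt0 ltr0n.
have m1 := @measurable_box R d (fun=> d.+1%:R^-1).
apply: lt_le_trans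
  (_ : (0 < mu [set v | forall i, (`|v 0 i| <= d.+1%:R^-1)%R])%E) _.
  rewrite muB => [|i]; last exact: ltW.
  by rewrite lte_fin prodr_gt0 // => i _; rewrite mulr_gt0.
apply: le_measure; rewrite ?inE //; first exact: measurable_unit_ball.
move=> v /= v1; rewrite /unit_ball /= -sqr_enorm expr_le1 ?enorm_ge0 //.
apply: le_trans (enorm_le_sum v) _.
apply: le_trans (ler_sum _ (fun i _ => v1 i)) _.
rewrite sumr_const card_ord -[leLHS]mulr_natr ler_pdivrMl ?ltr0n //.
by rewrite mulr1 ler_nat.
Qed.

Lemma mule_fin_inj (r : R) (x y : \bar R) : r != 0 ->
  (r%:E * x = r%:E * y -> x = y)%E.
Proof.
move=> r0 /(congr1 (mule r^-1%:E)).
by rewrite !muleA -!EFinM mulVf // !mul1e.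
Qed.

(** The unit ball is its own image, so the constant by which an isometry
    could multiply volumes is one. *)
Lemma measure_isometry (h : 'M[R]_d) (B : set 'rV[R]_d) :
  isometry_mx h -> measurable B -> mu [set y | B (y *m h)] = mu B.
Proof.
move=> oh mB.
have uh := isometry_unitmx oh.
have := measure_linear_exchange muD uh measurable_unit_ball mB.
have -> : [set y | unit_ball (- (y *m h))] = @unit_ball R d.
  by apply/seteqP; split => y; rewrite /unit_ball /= !dotE opprK dot_isometry.
rewrite [RHS]muleC -(fineK unit_ball_fin_num) ; apply: mule_fin_inj.
by rewrite gt_eqF // fine_gt0 // unit_ball_gt0 -ge0_fin_numE ?unit_ball_fin_num.
Qed.

(** The unit cube is sent to a box, whose volume gives the constant. *)
Lemma measure_diag (s : 'rV[R]_d) (B : set 'rV[R]_d) :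
  (forall i, 0 < s 0 i) -> measurable B ->
  mu [set y | B (y *m diag_mx s)] = ((\prod_i s 0 i)^-1%:E * mu B)%E.
Proof.
move=> s0 mB; pose A := [set v : 'rV[R]_d | forall i, `|v 0 i| <= 1].
have us : diag_mx s \in unitmx.
  by rewrite unitmxE det_diag unitfE; apply/prodf_neq0 => i _; rewrite gt_eqF.
have := measure_linear_exchange muD us (@measurable_box R d (fun=> 1)) mB.
have -> : [set y : 'rV[R]_d | forall i, `|(- (y *m diag_mx s)) 0 i| <= 1] =
    [set y | forall i, `|y 0 i| <= (s 0 i)^-1].
  apply/seteqP; split => y /= h i; have := h i;
    rewrite mxE normrN mul_mx_diag mxE normrM (gtr0_norm (s0 i));
    by rewrite -ler_pdivlMr // mul1r.
rewrite !muB // => [|i]; last by rewrite invr_ge0 ltW.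
have p0 : \prod_i s 0 i != 0 by apply/prodf_neq0 => i _; rewrite gt_eqF.
have c0 : \prod_(i < d) (2 * 1) != 0 :> R.
  by apply/prodf_neq0 => i _; rewrite mulr1 pnatr_eq0.
have -> : \prod_i (2 / s 0 i) = \prod_(i < d) (2 * 1) * (\prod_i s 0 i)^-1.
  by rewrite -prodfV -big_split; apply: eq_bigr => i _; rewrite mulr1.
by rewrite EFinM [RHS]muleC -muleA; apply: mule_fin_inj.
Qed.

(** For a unit vector [x], compression by [l] towards the axis of [x] and by
    [k] along this axis, followed by a translation. *)
Definition axial_map (a x : 'rV[R]_d) (k l : R) (z : 'rV[R]_d) : 'rV[R]_d :=
  a + (l *: z + ((k - l) * dot z x) *: x).

End volume.

(** An isometry taking [x] to a coordinate axis makes the map diagonal. *)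
Lemma measure_axial_map (R : realType) (n : nat)
    (mu : {sigma_finite_measure set 'rV[R]_n.+1 -> \bar R})
    (a x : 'rV[R]_n.+1) (k l : R) (B : set 'rV[R]_n.+1) :
  translation_invariant mu -> box_formula mu ->
  dot x x = 1 -> 0 < k -> 0 < l -> measurable B ->
  mu [set z | B (axial_map a x k l z)] = ((k * l ^+ n)^-1%:E * mu B)%E.
Proof.
move=> muD muB x1 k0 l0 mB.
pose e0 : 'rV[R]_n.+1 := delta_mx 0 0.
have dot0 v : dot v e0 = v 0 0.
  rewrite /dot (bigD1 ord0) //= !mxE eqxx mulr1 big1 ?addr0 // => i i0.
  by rewrite !mxE (negbTE i0) mulr0.
have [h oh xh] : exists2 h, isometry_mx h & x *m h = e0.
  by apply: isometry_transitive; rewrite !enormE x1 dot0 mxE.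
pose s : 'rV[R]_n.+1 := \row_i (if i == 0 then k else l).
have sE i : s 0 i = if i == 0 then k else l by rewrite /s mxE.
have s0 i : 0 < s 0 i by rewrite sE; case: ifP.
have e z : axial_map 0 x k l z = z *m h *m diag_mx s *m h^T.
  have -> : z *m h *m diag_mx s = l *: (z *m h) + ((k - l) * dot z x) *: e0.
    apply/rowP => i; rewrite -(dot_isometry z x oh) xh dot0.
    move: (z *m h) => y.
    rewrite mul_mx_diag !mxE eqxx /=; case: eqP => [->|_].
      by rewrite mulr1n; ring.
    by rewrite mulr0n; ring.
  rewrite mulmxDl -!scalemxAl -mulmxA oh mulmx1 -xh -mulmxA oh mulmx1.
  by rewrite /axial_map add0r.
have mBa : measurable [set z | B (a + z)].
  have : measurable_fun setT (fun v : 'rV[R]_n.+1 => a + v).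
    apply: measurable_fun_rV => i; under eq_fun do rewrite mxE.
    by apply: measurable_funD => //; exact: measurable_coord.
  by move=> /(_ measurableT B mB); rewrite setTI.
have m1 := measurable_preim_mulmx h^T mBa.
have m2 := measurable_preim_mulmx (diag_mx s) m1.
have -> : [set z | B (axial_map a x k l z)] =
    [set z | [set y | [set w | [set v | B (a + v)] (w *m h^T)]
      (y *m diag_mx s)] (z *m h)].
  by apply/seteqP; split => z /=; rewrite -e /axial_map add0r.
rewrite measure_isometry // measure_diag // measure_isometry //; last first.
  exact: isometry_mxT.
congr (_ * _)%E; last exact: (muD a B mB).
rewrite big_ord_recl sE eqxx; congr ((_ * _)^-1%:E).
by rewrite (eq_bigr (fun=> l)) ?prodr_const ?card_ord // => i _; rewrite sE.
Qed.

(** * Nets on the sphere and averages over isometries *)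

Section nets.
Context {R : realType} {d : nat}.
Implicit Types (u v y : 'rV[R]_d) (h : 'M[R]_d).

(** The cells of a cubical grid of mesh [e / d]. Their number is far from
    optimal, but only its logarithm enters the number of isometries used in
    the end. *)
Lemma sphere_net (e : R) : 0 < e ->
  exists (Q : finType) (q : 'rV[R]_d -> Q),
    #|Q|%:R <= expR (2 * d%:R ^+ 2 / e) /\
    forall u v, enorm u = 1 -> enorm v = 1 -> q u = q v -> enorm (u - v) <= e.
Proof.
move=> e0; pose k := d%:R / e; pose m := Num.truncn (2 * k).
have k0 : 0 <= k by rewrite divr_ge0 // ltW.
exists {ffun 'I_d -> 'I_m.+1},
  (fun u => [ffun i => inord (Num.truncn ((u 0 i + 1) * k))]).
split.
  rewrite card_ffun !card_ord natrX.
  have -> : 2 * d%:R ^+ 2 / e = d%:R * (2 * k) by rewrite /k; ring.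
  rewrite expRM_natl lerXn2r ?nnegrE ?expR_ge0 //.
  apply: le_trans (expR_ge1Dx _); rewrite -natr1 addrC lerD2l.
  by rewrite truncn_le mulr_ge0.
move=> u v u1 v1 /ffunP quv; have [d0|d0] := posnP d.
  rewrite [u - v](_ : _ = 0) ?enorm0 ?ltW //.
  by apply/rowP => i; have := ltn_ord i; rewrite [X in (_ < X)%N]d0.
have kp : 0 < k by rewrite divr_gt0 // ltr0n.
have range (w : 'rV[R]_d) i : enorm w = 1 -> 0 <= (w 0 i + 1) * k <= 2 * k.
  move=> w1; have := norm_coord_le w i; rewrite w1 ler_norml => /andP[h1 h2].
  by rewrite ler_pM2r // mulr_ge0 //=; lra.
apply: le_trans (enorm_le_sum _) _.
have coord i : `|(u - v) 0 i| <= e / d%:R.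
  have := quv i; rewrite !ffunE => /(congr1 (@nat_of_ord _)).
  have /andP[u0 u2] := range u i u1; have /andP[v0 v2] := range v i v1.
  rewrite !inordK ?ltnS ?le_truncn // => tuv.
  have /andP[a1 a2] := truncn_itv u0; have /andP[b1 b2] := truncn_itv v0.
  rewrite -(ler_pM2r kp) -[k in leLHS]gtr0_norm // -normrM.
  have -> : e / d%:R * k = 1.
    by rewrite /k; field; rewrite gt_eqF //= pnatr_eq0 -lt0n.
  move: a1 a2; rewrite tuv => a1 a2; rewrite !mxE ler_norml -natr1 in a2 b2 *.
  by apply/andP; split; lra.
apply: le_trans (ler_sum _ (fun i _ => coord i)) _.
by rewrite sumr_const card_ord -[leLHS]mulr_natr divfK // pnatr_eq0 -lt0n.
Qed.

Lemma transitive_net (Q : finType) (q : 'rV[R]_d -> Q) (e : R) (y0 : 'rV[R]_d) :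
  (forall u v, enorm u = 1 -> enorm v = 1 -> q u = q v -> enorm (u - v) <= e) ->
  enorm y0 = 1 ->
  exists hs : seq 'M[R]_d, [/\ size hs = #|Q|,
    forall h, h \in hs -> isometry_mx h &
    forall y, enorm y = 1 -> exists2 h, h \in hs & enorm (y *m h - y0) <= e].
Proof.
move=> qP y01.
have hP c : exists h, isometry_mx h /\
    forall y, enorm y = 1 -> q y = c -> enorm (y *m h - y0) <= e.
  have [[u [u1 qu]]|nou] := pselect (exists u, enorm u = 1 /\ q u = c).
    have [h oh uh] : exists2 h, isometry_mx h & u *m h = y0.
      by apply: isometry_transitive; rewrite u1.
    exists h; split=> // y y1 qy.
    by rewrite -uh -mulmxBl enorm_isometry // qP // qy qu.
  exists 1%:M; split; first exact: isometry_mx1.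
  by move=> y y1 qy; case: nou; exists y.
pose H c := sval (cid (hP c)).
have HP c : isometry_mx (H c) /\
    forall y, enorm y = 1 -> q y = c -> enorm (y *m H c - y0) <= e.
  by rewrite /H; case: cid.
exists [seq H c | c : Q]; split; first by rewrite size_map -cardE.
- by move=> h /mapP[c _ ->]; have [] := HP c.
- move=> y y1; exists (H (q y)); first by apply/map_f; rewrite mem_enum.
  by have [_] := HP (q y); apply.
Qed.

End nets.

Lemma ler_sum_const_seq (R : realType) (T : eqType) (s : seq T) (F : T -> R)
  (c : R) : {in s, forall x, c <= F x} -> c * (size s)%:R <= \sum_(x <- s) F x.
Proof.
elim: s => [|x s IH] h; first by rewrite big_nil mulr0.
rewrite big_cons /= -natr1 mulrDr mulr1 addrC.
rewrite lerD ?h ?mem_head // IH // => y ys.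
by rewrite h // in_cons ys orbT.
Qed.

Section averaging.
Context {R : realType} {d : nat}.
Variables (f : 'rV[R]_d -> R) (p K : R).
Hypotheses (f0 : forall y, 0 <= f y) (K0 : 0 < K)
  (flip : forall u v, f u - f v <= K * enorm (u - v))
  (fdeep : forall gs : seq 'M[R]_d, (forall g, g \in gs -> isometry_mx g) ->
     exists2 y, enorm y = 1 & p * (size gs)%:R <= \sum_(g <- gs) f (y *m g)).

(** The minimum of an average of isometric copies of [f] can be raised: the
    average is large somewhere, hence near some point, and boundedly many
    isometries, independent of the average, bring every point there. *)
Lemma average_step (e : R) : 0 < e -> exists2 N : nat, (0 < N)%N &
  forall (c : R) (gs : seq 'M[R]_d), c <= p - e ->
    (forall g, g \in gs -> isometry_mx g) ->
    (forall y, enorm y = 1 -> c * (size gs)%:R <= \sum_(g <- gs) f (y *m g)) ->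
  exists gs' : seq 'M[R]_d, [/\ size gs' = (N * size gs)%N,
    forall g, g \in gs' -> isometry_mx g &
    forall y, enorm y = 1 ->
      (c + (p - e - c) / N%:R) * (size gs')%:R <= \sum_(g <- gs') f (y *m g)].
Proof.
move=> e0; have [Q [q [_ qP]]] := sphere_net (R := R) (d := d) (divr_gt0 e0 K0).
have [y00 _ _] := @fdeep [::] ltac:(by []).
exists #|Q|; first by apply/card_gt0P; exists (q y00).
move=> c gs ce ogs gsP.
have [y0 y0u y0P] := fdeep ogs.
have [hs [shs ohs hsP]] := transitive_net qP y0u.
exists [seq h *m g | h <- hs, g <- gs]; split.
- by rewrite size_allpairs shs.
- move=> _ /allpairsP[[h g] /= [hh gg ->]].
  by apply: isometry_mxM; [exact: ohs|exact: ogs].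
move=> y y1; rewrite size_allpairs shs big_allpairs_dep /=.
have [h0 h0in h0P] := hsP y y1.
have Q0 : #|Q|%:R != 0 :> R.
  by rewrite pnatr_eq0 -lt0n; apply/card_gt0P; exists (q y00).
have low h : h \in hs -> c * (size gs)%:R <= \sum_(g <- gs) f (y *m (h *m g)).
  move=> hh; under eq_bigr do rewrite mulmxA.
  by apply: gsP; rewrite enorm_isometry //; exact: ohs.
have high : (p - e) * (size gs)%:R <= \sum_(g <- gs) f (y *m (h0 *m g)).
  rewrite mulrBl lerBlDr; apply: le_trans y0P _.
  rewrite -lerBlDl -sumrB.
  suff : (- e) * (size gs)%:R <=
      \sum_(g <- gs) (f (y *m (h0 *m g)) - f (y0 *m g)).
    by rewrite !sumrB mulNr; lra.
  apply: ler_sum_const_seq => g gg; rewrite lerNl opprB.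
  apply: le_trans (flip _ _) _; rewrite mulmxA -mulmxBl enorm_isometry;
    last exact: ogs.
  by rewrite enormC mulrC -ler_pdivlMr.
rewrite (big_rem h0) //=.
have -> : (c + (p - e - c) / #|Q|%:R) * (#|Q| * size gs)%:R =
    (p - e) * (size gs)%:R + (size (rem h0 hs))%:R * (c * (size gs)%:R).
  rewrite size_rem // shs -subn1 natrB; last by rewrite -shs; case: (hs) h0in.
  by rewrite natrM; field.
(* The isometry h0 brings y near y0; the old minimum serves for the others. *)
apply: lerD => //; rewrite mulrC; apply: ler_sum_const_seq => h /mem_rem.
exact: low.
Qed.

(** Each step multiplies the distance to [p - e] by a fixed factor below one. *)
Lemma average_min (e : R) : 0 < e -> e <= p -> p <= 1 ->
  exists gs : seq 'M[R]_d, [/\ (0 < size gs)%N,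
    forall g, g \in gs -> isometry_mx g &
    forall y, enorm y = 1 ->
      (p - e *+ 2) * (size gs)%:R <= \sum_(g <- gs) f (y *m g)].
Proof.
move=> e0 ep p1; have [N N0 step] := average_step e0.
have N1 : 1 <= N%:R :> R by rewrite ler1n.
pose x := 1 - N%:R^-1 : R.
have x0 : 0 <= x by rewrite subr_ge0 invf_le1 // ltr0n.
have xlt1 : x < 1 by rewrite ltrBlDr ltrDl invr_gt0 ltr0n.
have iter k : exists gs : seq 'M[R]_d, [/\ (0 < size gs)%N,
    forall g, g \in gs -> isometry_mx g &
    forall y, enorm y = 1 ->
      (p - e - x ^+ k * (p - e)) * (size gs)%:R <= \sum_(g <- gs) f (y *m g)].
  elim: k => [|k [gs [gs0 ogs gsP]]].
    exists [:: 1%:M]; split => // [g|y y1].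
      by rewrite inE => /eqP ->; exact: isometry_mx1.
    by rewrite mul1r subrr mul0r big_seq1.
  have [|gs' [s' ogs' gsP']] := step _ _ _ ogs gsP.
    by rewrite gerBl mulr_ge0 ?exprn_ge0 // subr_ge0.
  exists gs'; split => // [|y y1]; first by rewrite s' muln_gt0 N0.
  apply: le_trans (gsP' y y1); rewrite le_eqVlt; apply/orP; left; apply/eqP.
  by congr (_ * _); rewrite exprS /x; field; rewrite pnatr_eq0 -lt0n.
have : (x ^+ k)@[k --> \oo] --> 0 by apply: cvg_expr; rewrite ger0_norm.
move=> /cvgrPdist_le /(_ e e0) [k _ /(_ k (leqnn _))] /=.
rewrite sub0r normrN ger0_norm ?exprn_ge0 // => xk.
have [gs [gs0 ogs gsP]] := iter k; exists gs; split => // y y1.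
apply: le_trans (gsP y y1); rewrite ler_wpM2r ?ler0n //.
have : x ^+ k * (p - e) <= e by rewrite -[leRHS]mulr1 ler_pM ?exprn_ge0 //; lra.
by lra.
Qed.

End averaging.

Section deep_point.
Context {R : realType} {d : nat}.
Variable mu : {sigma_finite_measure set 'rV[R]_d -> \bar R}.
Hypotheses (muD : translation_invariant mu) (muB : box_formula mu).
Local Open Scope ereal_scope.

(** The isometric copies of [W] have total volume at least [p] times their
    number times the volume of the ball, which contains them all. *)
Lemma exists_deep_point (W : set 'rV[R]_d) (p : R) (gs : seq 'M[R]_d) :
  measurable W -> W `<=` unit_ball -> p%:E * mu unit_ball <= mu W ->
  (forall g, g \in gs -> isometry_mx g) ->
  exists z : 'rV[R]_d,
    (p * (size gs)%:R <= (count (fun g => `[< W (z *m g) >]) gs)%:R)%R.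
Proof.
move=> mW Wb pW ogs.
pose cnt (z : 'rV[R]_d) := count (fun g => `[< W (z *m g) >]) gs.
have ex : exists k, `[< exists z, cnt z = k >].
  by exists (cnt 0%R); apply/asboolP; exists 0%R.
have ub k : `[< exists z, cnt z = k >] -> (k <= size gs)%N.
  by move=> /asboolP[z <-]; exact: count_size.
case: (ex_maxnP ex ub) => k /asboolP[z zk] kmax.
exists z; rewrite -/(cnt z) zk.
have cntk y : (cnt y <= k)%N by apply: kmax; apply/asboolP; exists y.
pose E (g : 'M[R]_d) := [set y : 'rV[R]_d | W (y *m g)].
have mE g : measurable (E g) by exact: measurable_preim_mulmx.
have sumE : \int[mu]_y \sum_(g <- gs) (\1_(E g) y)%:E = (size gs)%:R%:E * mu W.
  rewrite ge0_integral_sum // => [|g].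
    rewrite big_seq (eq_bigr (fun=> mu W)) => [|g gg].
      rewrite -big_seq big_const_seq count_predT.
      elim: (size gs) => [|m IH] /=; first by rewrite mul0e.
      by rewrite IH -natr1 EFinD ge0_muleDl ?lee_fin // mul1e addeC.
    by rewrite integral_indic // setIT; exact: measure_isometry (ogs g gg) mW.
  by apply/measurable_EFinP; exact: measurable_indic.
have : (size gs)%:R%:E * mu W <= k%:R%:E * mu unit_ball.
  have mb : measurable_fun setT
      (fun y : 'rV[R]_d => (\1_unit_ball y)%:E : \bar R).
    apply/measurable_EFinP; apply: measurable_indic.
    exact: measurable_unit_ball.
  have <- : \int[mu]_y (k%:R%:E * (\1_unit_ball y)%:E) = k%:R%:E * mu unit_ball.
    rewrite ge0_integralZl // ?lee_fin // integral_indic ?setIT //.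
    exact: measurable_unit_ball.
  rewrite -sumE.
  apply: ge0_le_integral => //.
  - by move=> y _; apply: sume_ge0 => g _; rewrite lee_fin.
  - apply: emeasurable_sum => g; apply/measurable_EFinP.
    exact: measurable_indic.
  - exact: measurable_funeM.
  move=> y _; rewrite sumEFin -EFinM lee_fin.
  have -> : (\sum_(g <- gs) \1_(E g) y)%R = (cnt y)%:R :> R.
    rewrite /cnt -sum1_count natr_sum [RHS]big_mkcond /=; apply: eq_bigr => g _.
    rewrite indicE; case: asboolP => h; first by rewrite mem_set.
    by rewrite memNset.
  rewrite indicE; have [yb|yb] := pselect (unit_ball y).
    by rewrite mem_set // mulr1 ler_nat.
  rewrite (_ : cnt y = 0)%N ?mulr_ge0 //.
  apply/eqP; rewrite -leqn0 leqNgt -has_count.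
  apply/negP => /hasP[g gg /asboolP /Wb].
  by rewrite /unit_ball /= dot_isometry //; exact: ogs.
move=> h; have gs0 : 0 <= (size gs)%:R%:E :> \bar R by rewrite lee_fin.
have := le_trans (lee_wpmul2l gs0 pW) h.
have := unit_ball_gt0 muB; move: (unit_ball_fin_num muB).
case: (mu unit_ball) => // r _; rewrite lte_fin => r0.
by rewrite -!EFinM !lee_fin mulrA ler_pM2r // mulrC.
Qed.

End deep_point.

(** * Covering the sphere by isometric copies of a set *)

Lemma exists_ge_average (R : realType) (T : eqType) (s : seq T) (F : T -> R)
  (c : R) : (0 < size s)%N -> c * (size s)%:R <= \sum_(x <- s) F x ->
  exists2 x, x \in s & c <= F x.
Proof.
elim: s => // x s IH _; rewrite big_cons /= -natr1 => h.
have [cx|xc] := leP c (F x); first by exists x; rewrite ?mem_head.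
have [s0|s0] := posnP (size s).
  by move: h; rewrite (size0nil s0) big_nil /=; lra.
have [|y ys cy] := IH s0; first by lra.
by exists y; rewrite // in_cons ys orbT.
Qed.

(** If every point is covered by at least a proportion [p] of the sets, then
    some set covers at least a proportion [p] of the points not yet covered. *)
Lemma greedy_cover (R : realType) (U : finType) (G : eqType) (gs : seq G)
    (cov : G -> U -> bool) (p : R) :
  p <= 1 -> (0 < size gs)%N ->
  (forall u, p * (size gs)%:R <= (count (fun g => cov g u) gs)%:R) ->
  forall N, exists s : seq G, [/\ size s = N, {subset s <= gs} &
    #|[set u | ~~ has (fun g => cov g u) s]%SET|%:R <= (1 - p) ^+ N * #|U|%:R].
Proof.
move=> p1 gs0 gsP; elim=> [|N [s [sN sgs sP]]].
  by exists [::]; split=> //; rewrite mul1r ler_nat max_card.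
pose V := [set u | ~~ has (fun g => cov g u) s]%SET.
have : p * #|V|%:R * (size gs)%:R <=
    \sum_(g <- gs) #|[set u in V | cov g u]%SET|%:R.
  have -> : \sum_(g <- gs) #|[set u in V | cov g u]%SET|%:R =
      \sum_(u in V) (count (fun g => cov g u) gs)%:R :> R.
    rewrite -!natr_sum; congr (_%:R).
    rewrite (eq_bigr (fun g => \sum_(u in V) cov g u)%N) => [|g _].
      rewrite exchange_big; apply: eq_bigr => u _.
      rewrite -sum1_count [RHS]big_mkcond.
      by apply: eq_bigr => g _; case: (cov _ _).
    rewrite -sum1_card [RHS]big_mkcond [LHS]big_mkcond /=.
    by apply: eq_bigr => u _; rewrite inE; case: (u \in V); case: (cov _ _).
  rewrite mulrAC -sum1_card natr_sum mulr_sumr.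
  by apply: ler_sum => u _; rewrite mulr1.
move=> /(exists_ge_average gs0) [g ggs gV].
exists (g :: s); split; first by rewrite /= sN.
  by move=> x; rewrite in_cons => /predU1P[->|/sgs].
have -> : [set u | ~~ has (fun g => cov g u) (g :: s)]%SET =
    (V :\: [set u in V | cov g u])%SET.
  apply/setP => u; rewrite /V !inE /= negb_or.
  by case: (cov g u); case: (has _ _).
have sV : [set u in V | cov g u]%SET \subset V.
  by apply/fintype.subsetP => u; rewrite inE => /andP[].
rewrite cardsD (finset.setIidPr sV) natrB ?subset_leq_card //.
rewrite exprS -mulrA; apply: le_trans (_ : (1 - p) * #|V|%:R <= _).
  by lra.
by rewrite ler_wpM2l // subr_ge0.
Qed.

Section distance_to_set.
Context {R : realType} {d : nat}.
Variables (V : set 'rV[R]_d) (V0 : V !=set0).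

Let dist (y : 'rV[R]_d) : R := inf [set enorm (y - v) | v in V].

Let dist_le y v : V v -> dist y <= enorm (y - v).
Proof.
move=> Vv; apply: ge_inf; last by exists v.
by exists 0 => _ [w _ <-]; exact: enorm_ge0.
Qed.

Let dist_lip y z : dist y <= dist z + enorm (y - z).
Proof.
rewrite -lerBlDr; apply: lb_le_inf.
  by have [v Vv] := V0; exists (enorm (z - v)), v.
move=> _ [v Vv <-]; rewrite lerBlDl.
exact: le_trans (dist_le y Vv) (ler_enormB _ _ _).
Qed.

Lemma exists_tent (s : R) : 0 < s -> exists f : 'rV[R]_d -> R,
  [/\ forall y, 0 <= f y <= 1, forall v, V v -> 1 <= f v,
      forall u v, f u - f v <= s^-1 * enorm (u - v) &
      forall y, 0 < f y -> exists2 v, V v & enorm (y - v) < s].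
Proof.
move=> s0; have s'0 : 0 < s^-1 by rewrite invr_gt0.
have dist0 y : 0 <= dist y.
  apply: lb_le_inf; last by move=> _ [w _ <-]; exact: enorm_ge0.
  by have [v Vv] := V0; exists (enorm (y - v)), v.
exists (fun y => Num.max 0 (1 - s^-1 * dist y)); split => [y|v Vv|u v|y].
- by rewrite le_max lexx /= ge_max ler01 /= gerBl mulr_ge0 // ltW.
- have := dist_le v Vv; rewrite subrr enorm0 => h.
  have -> : dist v = 0 by apply/le_anti; rewrite h dist0.
  by rewrite mulr0 subr0 le_max lexx orbT.
- rewrite lerBlDr ge_max; apply/andP; split.
    by rewrite addr_ge0 ?le_max ?lexx // mulr_ge0 ?enorm_ge0 // ltW.
  apply: le_trans (_ : s^-1 * enorm (u - v) + (1 - s^-1 * dist v) <= _);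
    last first.
    by rewrite lerD2l le_max lexx orbT.
  have := ler_wpM2l (ltW s'0) (dist_lip v u); rewrite mulrDr enormC; lra.
- rewrite lt_max ltxx /= subr_gt0 mulrC ltr_pdivrMr // mul1r => h.
  have [|_ [v Vv <-] yv] := inf_lt _ h; last by exists v.
  by have [v Vv] := V0; exists (enorm (y - v)), v.
Qed.

End distance_to_set.

(** An average of isometric copies of a tent function over [W] is at least
    [p / 2] on the sphere, so that greedily chosen isometries cover the cells
    of a net; the radius [s] of the tents and that of the cells add up. *)
Lemma covering_by_isometries (R : realType) (n : nat)
    (mu : {sigma_finite_measure set 'rV[R]_n.+1 -> \bar R})
    (W : set 'rV[R]_n.+1) (p s : R) (N : nat) :
  translation_invariant mu -> box_formula mu ->
  measurable W -> W `<=` unit_ball -> (forall w, W w -> w != 0) ->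
  0 < p -> p <= 1 -> (p%:E * mu unit_ball <= mu W)%E -> 0 < s ->
  4 * n.+1%:R ^+ 2 / s < p * N%:R ->
  exists gs : seq 'M[R]_n.+1, [/\ size gs = N,
    forall g, g \in gs -> isometry_mx g &
    forall y, enorm y = 1 -> exists2 g, g \in gs &
      exists2 w, W w & enorm (y *m g - (enorm w)^-1 *: w) < s *+ 2].
Proof.
move=> muD muB mW Wb Wn0 p0 p1 pW s0 Np.
have [W0|W0] := pselect (W !=set0); last first.
  move: pW; have -> : W = set0.
    by rewrite -subset0 => w Ww; apply: W0; exists w.
  by rewrite measure0 leNgt mule_gt0 // unit_ball_gt0.
pose V := [set (enorm w)^-1 *: w | w in W].
have V0 : V !=set0 by have [w Ww] := W0; exists ((enorm w)^-1 *: w), w.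
have [f [f01 fV flip fpos]] := exists_tent V0 s0.
have f0 y : 0 <= f y by have /andP[] := f01 y.
have e1 := @enorm_delta R n.+1 0.
have deep gs : (forall g, g \in gs -> isometry_mx g) ->
    exists2 y : 'rV[R]_n.+1, enorm y = 1 &
      p * (size gs)%:R <= \sum_(g <- gs) f (y *m g).
  move=> ogs; have [z zP] := exists_deep_point muD muB mW Wb pW ogs.
  have [z0|z0] := eqVneq z 0.
    exists (delta_mx 0 0) => //; apply: le_trans zP _.
    rewrite (_ : count _ _ = 0)%N ?sumr_ge0 //.
    apply/eqP; rewrite -leqn0 leqNgt -has_count.
    apply/negP => /hasP[g gg /asboolP].
    by rewrite z0 mul0mx => /Wn0; rewrite eqxx.
  have nz0 : enorm z != 0 by rewrite enorm_eq0.
  exists ((enorm z)^-1 *: z).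
    by rewrite enormZ normfV ger0_norm ?enorm_ge0 // mulVf.
  apply: le_trans zP _; rewrite -sum1_count natr_sum big_mkcond /=.
  rewrite big_seq_cond [leRHS]big_seq_cond; apply: ler_sum => g /andP[gg _].
  case: asboolP => h //; apply: fV; exists (z *m g) => //.
  by rewrite enorm_isometry ?scalemxAl //; exact: ogs.
have s'0 : 0 < s^-1 by rewrite invr_gt0.
have p20 : 0 < p / 4 by lra.
have [||gs [gs0 ogs gsP]] := average_min f0 s'0 flip deep p20 => //.
  by lra.
have [Q [q [Qcard qP]]] := @sphere_net R n.+1 s s0.
have repP c : exists u : 'rV[R]_n.+1, enorm u = 1 /\
    forall y, enorm y = 1 -> q y = c -> enorm (y - u) <= s.
  have [[u [u1 qu]]|nou] := pselect (exists u, enorm u = 1 /\ q u = c).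
    by exists u; split=> // y y1 qy; apply: qP => //; rewrite qy.
  by exists (delta_mx 0 0); split=> // y y1 qy; case: nou; exists y.
pose rep c := sval (cid (repP c)).
have rep1 c : enorm (rep c) = 1 by have [] := svalP (cid (repP c)).
have repq c y : enorm y = 1 -> q y = c -> enorm (y - rep c) <= s.
  by move=> y1 qy; have [_] := svalP (cid (repP c)); apply.
pose cov (g : 'M[R]_n.+1) c := 0 < f (rep c *m g).
have [|c|ts [tsN tsgs tsP]] := @greedy_cover R Q _ gs cov (p / 2) _ gs0 _ N.
- by lra.
- apply: le_trans (_ : (p - p / 4 *+ 2) * (size gs)%:R <= _).
    by rewrite ler_wpM2r ?ler0n //; lra.
  apply: le_trans (gsP _ (rep1 c)) _.
  rewrite -sum1_count natr_sum [leRHS]big_mkcond /=.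
  apply: ler_sum => g _; rewrite /cov; case: ltP => // _.
  by have /andP[] := f01 (rep c *m g).
exists ts; split => // [g /tsgs|y y1]; first exact: ogs.
have full : [set c | ~~ has (fun g => cov g c) ts]%SET = finset.set0.
  apply/eqP; rewrite -cards_eq0 -leqn0 -ltnS -(ltr_nat R).
  apply: le_lt_trans tsP _.
  apply: le_lt_trans
    (_ : expR (- (p / 2)) ^+ N * expR (2 * n.+1%:R ^+ 2 / s) < 1).
    apply: ler_pM => //; first by rewrite exprn_ge0 //; lra.
    by rewrite lerXn2r ?nnegrE ?expR_ge0 //; [lra|exact: expR_ge1Dx].
  rewrite -expRM_natl -expRD expR_lt1; move: Np; rewrite -!mulrA; lra.
have : q y \notin [set c | ~~ has (fun g => cov g c) ts]%SET.
  by rewrite full inE.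
rewrite inE negbK => /hasP[g gts /fpos [_ [w Ww <-] wP]].
exists g => //; exists w => //.
apply: le_lt_trans (ler_enormB _ (rep (q y) *m g) _) _.
rewrite mulr2n ler_ltD // -mulmxBl enorm_isometry; last exact/ogs/tsgs.
exact: repq.
Qed.

(** * Shrunk Voronoi cells *)

Section cells.
Context {R : realType} {d : nat}.
Variables (a b : R) (X : seq 'rV[R]_d).
Hypothesis Xunit : forall x, x \in X -> enorm x = 1.

(** The part of the Voronoi cell of [x] that lies in a cap and away from the
    hyperplanes bounding the Voronoi cell. The margin [e] leaves room for
    replacing a point of the sphere by a nearby point of a net. *)
Definition shrunk_cell (e : R) (x : 'rV[R]_d) : set 'rV[R]_d :=
  [set w | [/\ unit_ball w, b + e <= dot w x &
    forall x', x' \in X -> x' != x ->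
      (a + e) * enorm (x - x') <= dot w (x - x')]].

Definition color_class : set 'rV[R]_d :=
  [set y | exists2 x, x \in X & b < dot y x /\
    forall x', x' \in X -> x' != x -> a * enorm (x - x') < dot y (x - x')].

(** For two points of one cell, [y + y'] is longer than [2 * b], hence [y - y']
    shorter than [2 * a]. Two different cells lie on either side of the
    hyperplane bisecting their centres, each at distance more than [a]. *)
Lemma color_class_free (y y' : 'rV[R]_d) : 0 <= a -> 0 <= b ->
  a ^+ 2 + b ^+ 2 = 1 ->
  enorm y = 1 -> enorm y' = 1 -> color_class y -> color_class y' ->
  enorm (y - y') <> 2 * a.
Proof.
move=> a0 b0 ab y1 y1' [x xX [yb ya]] [x' xX' [yb' ya']] yy'.
have [xx'|xx'] := eqVneq x' x.
  rewrite xx' in yb'; have := cauchy_schwarz (y + y') x.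
  rewrite (Xunit xX) mulr1 dotDl => h.
  have : (2 * b) ^+ 2 < enorm (y + y') ^+ 2.
    by rewrite ltrXn2r ?nnegrE ?enorm_ge0 ?mulr_ge0 //; lra.
  have := congr1 (fun t => t ^+ 2) yy'.
  rewrite /= !sqr_enorm !dotE -!sqr_enorm y1 y1' (dotC y').
  by nra.
have h1 := ya _ xX' xx'.
have := ya' _ xX; rewrite eq_sym => /(_ xx'); rewrite enormC => h2.
have := cauchy_schwarz (y - y') (x - x'); rewrite yy' !dotE.
by move: h1 h2; rewrite !dotE; lra.
Qed.

Lemma shrunk_cell_neq0 e x w : 0 < b + e -> shrunk_cell e x w -> w != 0.
Proof.
by move=> be [_ h _]; apply/eqP => w0; move: h; rewrite w0 dot0l leNgt be.
Qed.

(** Rescaling [w] to the sphere only increases its nonnegative dot products. *)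
Lemma shrunk_cell_near (e : R) (x w y : 'rV[R]_d) : 0 <= a -> 0 <= b -> 0 < e ->
  x \in X -> shrunk_cell e x w -> enorm (y - (enorm w)^-1 *: w) < e ->
  color_class y.
Proof.
move=> a0 b0 e0 xX wc yw; have w0 : w != 0 by apply: shrunk_cell_neq0 wc; lra.
have [w1 wb wa] := wc; exists x => //.
have nw0 : 0 < enorm w by rewrite lt_def enorm_eq0 w0 enorm_ge0.
have nw1 : 1 <= (enorm w)^-1.
  by rewrite invf_ge1 // -(@expr_le1 _ 2) ?enorm_ge0 // sqr_enorm.
have near v t : 0 <= t -> t <= dot w v -> 0 < enorm v ->
    t - e * enorm v < dot y v.
  move=> t0 tw v0; have := cauchy_schwarz ((enorm w)^-1 *: w - y) v.
  rewrite dotBl dotZl enormC => h.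
  have h1 : enorm (y - (enorm w)^-1 *: w) * enorm v < e * enorm v.
    by rewrite ltr_pM2r.
  have h2 : dot w v <= (enorm w)^-1 * dot w v.
    by rewrite ler_peMl // (le_trans t0).
  by lra.
split.
  have be0 : 0 <= b + e by lra.
  by have := near x _ be0 wb; rewrite Xunit // => /(_ ltr01); lra.
move=> x' xX' xx'.
have n0 : 0 < enorm (x - x').
  by rewrite lt_def enorm_ge0 enorm_eq0 subr_eq0 eq_sym xx'.
have := near (x - x') ((a + e) * enorm (x - x')).
have p0 : 0 <= (a + e) * enorm (x - x') by rewrite mulr_ge0 ?enorm_ge0 //; lra.
by move=> /(_ p0 (wa _ xX' xx') n0); lra.
Qed.

Lemma shrunk_cell_disjoint e x x' w : 0 < a + e -> x \in X -> x' \in X ->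
  shrunk_cell e x w -> shrunk_cell e x' w -> x = x'.
Proof.
move=> ae xX xX' [_ _ h] [_ _ h']; apply/eqP/negP => /negP xx'.
have := h' _ xX xx'; have := h _ xX'; rewrite eq_sym => /(_ xx').
have : 0 < enorm (x - x') by rewrite lt_def enorm_ge0 enorm_eq0 subr_eq0 xx'.
rewrite (enormC x' x) !dotE => n0; have := mulr_gt0 ae n0; lra.
Qed.

Lemma measurable_shrunk_cell e x : measurable (shrunk_cell e x).
Proof.
rewrite (_ : shrunk_cell e x = unit_ball `&` [set w | b + e <= dot w x] `&`
  \bigcap_(x' in [set x' | x' \in X /\ x' != x])
    [set w | (a + e) * enorm (x - x') <= dot w (x - x')]); last first.
  apply/seteqP; split => [w [w1 w2 w3]|w [[w1 w2] w3]].
    by split=> // x' [xX' xx']; exact: w3.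
  by split=> // x' xX' xx'; exact: w3.
apply: measurableI; first apply: measurableI.
- exact: measurable_unit_ball.
- by apply: measurable_le_set => //; exact: measurable_dotr.
- apply: fin_bigcap_measurable.
    by apply: sub_finite_set (finite_seq X) => x' [].
  by move=> x' _; apply: measurable_le_set => //; exact: measurable_dotr.
Qed.

End cells.

Lemma seq_argmax (R : realType) (T : eqType) (F : T -> R) (s : seq T) :
  (0 < size s)%N -> exists2 x, x \in s & forall y, y \in s -> F y <= F x.
Proof.
elim: s => // x s IH _; have [s0|s0] := posnP (size s).
  exists x; rewrite ?mem_head // => y.
  by rewrite (size0nil s0) inE => /eqP ->.
have [y ys yP] := IH s0; have [xy|yx] := leP (F x) (F y).
  exists y; rewrite ?in_cons ?ys ?orbT // => z.
  by rewrite in_cons => /predU1P[->//|/yP].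
exists x; rewrite ?mem_head // => z; rewrite in_cons => /predU1P[->//|/yP zy].
exact: le_trans zy (ltW yx).
Qed.

(** With [c] and [q] the cosines of two angles whose sines are in the ratio
    [l], the quantity [c - l * q] grows with the angles, because its product
    with [c + l * q] is constantly [1 - l ^+ 2]. This gap bounds how far
    a shrunk cell stays from the hyperplanes bounding its Voronoi cell. *)
Lemma shrink_gap_le (R : realType) (l s s' c c' q q' : R) :
  0 < l -> l < 1 -> 0 <= s' -> s' <= s ->
  0 <= c -> 0 <= q -> 0 < c' -> 0 <= q' ->
  c ^+ 2 + l ^+ 2 * s ^+ 2 = 1 -> q ^+ 2 + s ^+ 2 = 1 ->
  c' ^+ 2 + l ^+ 2 * s' ^+ 2 = 1 -> q' ^+ 2 + s' ^+ 2 = 1 ->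
  c' - l * q' <= c - l * q.
Proof.
move=> l0 l1 s'0 ss c0 q0 c'0 q'0 ec eq ec' eq'.
have ss2 : s' ^+ 2 <= s ^+ 2 by rewrite lerXn2r ?nnegrE // (le_trans s'0).
have l2 : 0 < l ^+ 2 by rewrite exprn_gt0.
have ler2 u v : 0 <= u -> 0 <= v -> u ^+ 2 <= v ^+ 2 -> u <= v :> R.
  by move=> u0 v0; rewrite ler_pXn2r // nnegrE.
have qq : q <= q' by apply: ler2 => //; lra.
have cc : c <= c'.
  apply: ler2 => //; first exact: ltW.
  by have := ler_wpM2l (ltW l2) ss2; lra.
have sum_le : c + l * q <= c' + l * q' by rewrite lerD // ler_wpM2l // ltW.
have l21 : l ^+ 2 < 1 by rewrite expr_lt1 // ltW.
have prodE : (c - l * q) * (c + l * q) = 1 - l ^+ 2.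
  by have := congr1 ( *%R (l ^+ 2)) eq; lra.
have prodE' : (c' - l * q') * (c' + l * q') = 1 - l ^+ 2.
  by have := congr1 ( *%R (l ^+ 2)) eq'; lra.
have s0 : 0 <= c + l * q by rewrite addr_ge0 // mulr_ge0 // ltW.
have s'gt0 : 0 < c' + l * q' by rewrite ltr_wpDr // mulr_ge0 // ltW.
have p0 : 0 <= c - l * q.
  rewrite leNgt; apply/negP => pn; have := mulr_le0_ge0 (ltW pn) s0; lra.
rewrite -(ler_pM2r s'gt0) prodE' -prodE.
exact: ler_wpM2l.
Qed.

(** In the two lemmas below, [c] is the height of a compressed point along the
    axis of its centre [x], [2 * al] is the distance from [x] to another centre
    [x'], [t] their dot product, and [D] the dot product of [x'] with the
    component orthogonal to [x] of the point before compression. The conclusion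
    says that the compressed point is at distance at least [m] from the
    hyperplane bisecting [x] and [x']. *)

Section margins.
Context {R : realType}.
Variables (m k l A C CA QA c t D al : R).
Hypotheses (m0 : 0 < m) (k0 : 0 < k) (l0 : 0 < l) (A0 : 0 < A) (A1 : A <= 1).
Hypothesis slack : m + 3 * k <= A * (CA - l * QA).
Hypotheses (cC : C - 3 * k <= c) (alA : A <= al) (alE : 1 - t = 2 * al ^+ 2).

Let kA : 3 * k * A <= 3 * k.
Proof. by rewrite ler_piMr // mulr_ge0 // ltW. Qed.

Let al0 : 0 <= 2 * al.
Proof. by rewrite mulr_ge0 // (le_trans _ alA) // ltW. Qed.

(** Far from the axis: the point lies on its own side of the bisecting
    hyperplane, and the compression moves it away from it. *)
Lemma far_margin (Q z0 : R) : z0 <= Q -> CA - l * QA <= C - l * Q ->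
  D <= z0 * (1 - t) -> m * (2 * al) <= c * (1 - t) - l * D.
Proof.
move=> zQ gap Dz.
have mA : m <= (CA - l * QA - 3 * k) * A.
  by rewrite mulrBl [X in X - _]mulrC lerBrDr (le_trans _ slack) // lerD2l.
have g0 : 0 <= CA - l * QA - 3 * k.
  by rewrite -(pmulr_lge0 _ A0) (le_trans _ mA) // ltW.
have gc : CA - l * QA - 3 * k <= c - l * z0.
  have lz : l * z0 <= l * Q by rewrite ler_pM2l.
  by move: gap cC lz; lra.
have h : m <= (c - l * z0) * al by apply: le_trans mA _; rewrite ler_pM // ltW.
have lD : l * D <= l * (z0 * (1 - t)) by rewrite ler_pM2l.
have := ler_wpM2r al0 h; move: lD; rewrite alE; lra.
Qed.

(** Close to the axis: no bisecting hyperplane is near enough to matter. *)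
Lemma near_margin (s q : R) : CA <= C -> 0 <= c -> 0 <= s -> s <= A ->
  0 <= q -> q <= QA -> D <= s * (2 * al * q) ->
  m * (2 * al) <= c * (1 - t) - l * D.
Proof.
move=> CAC c0 s0 sA q0 qQ Ds.
have h1 : l * (s * q) <= l * (A * QA) by rewrite ler_pM2l // ler_pM.
have h2 : c * A <= c * al by rewrite ler_wpM2l.
have h3 : (CA - 3 * k) * A <= c * A.
  by rewrite ler_pM2r // (le_trans _ cC) // lerD2r.
have h4 : m <= c * al - l * (s * q).
  by move: h1 h2 h3 kA slack; lra.
have lD : l * D <= l * (s * (2 * al * q)) by rewrite ler_pM2l.
have := ler_wpM2r al0 h4; move: lD; rewrite alE; lra.
Qed.

End margins.

(** The height of the image of a point of height [z0] stays within [3 * k] of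
    the height [C] that would keep unit vectors on the sphere. *)
Lemma height_bounds (R : realType) (C k z0 : R)
    (c := k * (Num.truncn (C / k))%:R + k * (z0 - 1)) :
  0 < k -> 0 <= C -> -1 <= z0 <= 1 -> C - 3 * k <= c <= C.
Proof.
move=> k0 C0 /andP[z1 z2].
have Ck0 : 0 <= C / k by rewrite divr_ge0 // ltW.
have /andP[i1 i2] := truncn_itv Ck0; move: i1 i2; rewrite /c.
move: (Num.truncn _) => i.
rewrite ler_pdivlMr // ltr_pdivrMr // -natr1 => i1 i2.
have h1 : k * (-2) <= k * (z0 - 1) by rewrite ler_pM2l //; move: z1; clear; lra.
have h2 : k * (z0 - 1) <= k * 0 by rewrite ler_pM2l //; move: z2; clear; lra.
by apply/andP; split; move: h1 h2 i1 i2; clear; lra.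
Qed.

Lemma ler_sqr_le (R : realDomainType) (u v : R) :
  0 <= v -> u ^+ 2 <= v ^+ 2 -> u <= v.
Proof.
move=> v0; have [u0|u0] := leP 0 u; first by rewrite ler_pXn2r ?nnegrE.
by move=> _; rewrite (le_trans (ltW u0)).
Qed.

(** The map multiplies the distance to the axis of [x] by [l] and replaces the
    height along this axis by one slightly below the height that would keep
    unit vectors on the sphere. *)
Lemma axial_map_shrunk_cell (R : realType) (d : nat) (a b e k l A sg : R)
    (X : seq 'rV[R]_d) (x z : 'rV[R]_d) :
  0 <= a -> 0 <= b -> 0 < e -> 0 < k -> 0 < l -> l < 1 -> 0 < A -> A <= 1 ->
  b + e + 3 * k <= Num.sqrt (1 - l ^+ 2 * sg ^+ 2) ->
  (forall x, x \in X -> enorm x = 1) ->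
  (forall x x', x \in X -> x' \in X -> x' != x -> 2 * A <= enorm (x - x') /\
    a + e + 3 * k <=
      A * (Num.sqrt (1 - l ^+ 2 * A ^+ 2) - l * Num.sqrt (1 - A ^+ 2))) ->
  x \in X -> unit_ball z ->
  (forall x', x' \in X -> dot z x' <= dot z x) ->
  dot z z - dot z x ^+ 2 <= sg ^+ 2 ->
  exists i : 'I_(Num.truncn k^-1).+1,
    shrunk_cell a b X e x (axial_map ((k * i%:R - k) *: x) x k l z).
Proof.
move=> a0 b0 e0 k0 l0 l1 A0 A1 cap Xunit Xsep xX zb znear zsg.
have x1 := Xunit _ xX.
have xx1 : dot x x = 1 by rewrite -sqr_enorm x1 expr1n.
pose z0 := dot z x; pose s2 := dot z z - z0 ^+ 2.
have zz1 : dot z z <= 1 := zb.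
have s20 : 0 <= s2.
  have := dot_ge0 (z - z0 *: x); rewrite !dotE (dotC x z) -/z0 xx1 /s2.
  by clear; lra.
have z02 : z0 ^+ 2 <= 1 by move: s20 zz1; rewrite /s2; clear; lra.
have z0b : -1 <= z0 <= 1.
  by rewrite -ler_norml -(@expr_le1 _ 2) // real_normK ?num_real.
have s21 : s2 <= 1 by rewrite lerBlDr (le_trans zz1) // lerDl sqr_ge0.
have l2 : 0 < l ^+ 2 by rewrite exprn_gt0.
have l21 : l ^+ 2 < 1 by rewrite expr_lt1 // ltW.
pose s := Num.sqrt s2; have sE : s ^+ 2 = s2 by rewrite sqr_sqrtr.
have s0 : 0 <= s by exact: sqrtr_ge0.
pose cosl (u : R) := Num.sqrt (1 - l ^+ 2 * u).
have cosl_le u v : u <= v -> cosl v <= cosl u.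
  by move=> uv; apply: ler_wsqrtr; rewrite lerD2l lerN2 ler_pM2l.
have coslE u : u <= 1 -> cosl u ^+ 2 = 1 - l ^+ 2 * u.
  move=> u1; rewrite sqr_sqrtr // subr_ge0 (le_trans _ (ltW l21)) //.
  by rewrite ger_pMr.
have C1 : cosl s2 <= 1.
  by rewrite -sqrtr1; apply: ler_wsqrtr; rewrite gerBl mulr_ge0 // ltW.
have C0 : 0 <= cosl s2 by exact: sqrtr_ge0.
have ilt : (Num.truncn (cosl s2 / k) < (Num.truncn k^-1).+1)%N.
  by rewrite ltnS; apply: le_truncn; rewrite ler_piMl // invr_ge0 ltW.
exists (Ordinal ilt) => /=.
have := height_bounds k0 C0 z0b; set i := Num.truncn _.
set c := k * i%:R + _ => /andP[cC cC'].
have -> : axial_map ((k * i%:R - k) *: x) x k l z =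
    c *: x + l *: (z - z0 *: x).
  rewrite /axial_map -/z0 scalerBr scalerA addrCA [RHS]addrCA -scaleNr.
  by congr (_ + _); rewrite -!scalerDl; congr (_ *: _); rewrite /c; ring.
have cb : b + e <= c.
  apply: le_trans cC; rewrite lerBrDr; apply: le_trans cap _.
  exact: cosl_le zsg.
have c0 : 0 <= c by apply: le_trans cb; rewrite addr_ge0 // ltW.
have dotx v : dot (c *: x + l *: (z - z0 *: x)) v =
    c * dot x v - l * (z0 * dot x v - dot z v).
  by rewrite !dotE; clear; ring.
split.
- rewrite /unit_ball /= !dotE (dotC x z) -/z0 xx1.
  have h : c ^+ 2 <= cosl s2 ^+ 2 by rewrite lerXn2r ?nnegrE.
  rewrite (_ : c * _ + _ = c ^+ 2 + l ^+ 2 * s2); last by rewrite /s2; ring.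
  by rewrite -lerBrDr -coslE.
- by rewrite dotx xx1 -/z0 !mulr1 subrr mulr0 subr0.
move=> x' xX' xx'.
have [Ax slack] := Xsep _ _ xX xX' xx'.
pose t := dot x x'; pose al := enorm (x - x') / 2.
have xx1' : dot x' x' = 1 by rewrite -sqr_enorm Xunit ?expr1n.
have alE : 1 - t = 2 * al ^+ 2.
  rewrite /al expr_div_n sqr_enorm !dotE (dotC x' x) -/t xx1 xx1'.
  by clear; field.
have nE : enorm (x - x') = 2 * al by rewrite /al mulrC divfK.
have alA : A <= al by rewrite -(@ler_pM2l _ 2) // -nE.
have al0 : 0 <= al by apply: le_trans alA; exact: ltW.
have A21 : A ^+ 2 <= 1 by rewrite expr_le1 // ltW.
pose D := dot z x' - z0 * t.
have -> : dot (c *: x + l *: (z - z0 *: x)) (x - x') = c * (1 - t) - l * D.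
  by rewrite dotx !dotBr xx1 -/z0 -/t /D; clear; ring.
rewrite nE; have ae0 : 0 < a + e by rewrite ltr_wpDl.
have [As|sA] := leP A s.
- have QsE : Num.sqrt (1 - s2) ^+ 2 = 1 - s2 by rewrite sqr_sqrtr ?subr_ge0.
  apply: (far_margin ae0 k0 l0 A0 A1 slack cC alA alE
    (Q := Num.sqrt (1 - s2)) (z0 := z0)).
  + apply: ler_sqr_le; first exact: sqrtr_ge0.
    by rewrite QsE lerBrDr addrC /s2 subrK.
  + apply: (@shrink_gap_le R l s A) => //; rewrite ?sqrtr_ge0 ?(ltW A0) //.
    * by rewrite sqrtr_gt0 subr_gt0 (le_lt_trans _ l21) // ger_pMr.
    * by rewrite coslE // sE subrK.
    * by rewrite QsE sE subrK.
    * by rewrite -/(cosl _) coslE // subrK.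
    * by rewrite sqr_sqrtr ?subr_ge0 // subrK.
  + by rewrite /D mulrBr mulr1 lerD2r; exact: znear.
- pose q := Num.sqrt (1 - al ^+ 2).
  have al21 : al ^+ 2 <= 1.
    have : `|t| <= 1.
      by apply: le_trans (norm_dot_le x x') _; rewrite x1 Xunit // mulr1.
    by rewrite ler_norml; move: alE; clear; lra.
  have qE : q ^+ 2 = 1 - al ^+ 2 by rewrite sqr_sqrtr ?subr_ge0.
  have q0 : 0 <= q by exact: sqrtr_ge0.
  apply: (near_margin k0 l0 A0 A1 slack cC alA alE (s := s) (q := q)) => //.
  + by apply: cosl_le; rewrite -sE lerXn2r ?nnegrE ?(ltW A0) // ltW.
  + exact: ltW.
  + by apply: ler_wsqrtr; rewrite lerD2l lerN2 lerXn2r ?nnegrE // ltW.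
  + (* Only the part of x' orthogonal to x matters. *)
    have := cauchy_schwarz (z - z0 *: x) (x' - t *: x).
    have -> : enorm (z - z0 *: x) = s.
      rewrite enormE; congr Num.sqrt.
      by rewrite !dotE (dotC x z) -/z0 xx1 /s2; clear; ring.
    have -> : enorm (x' - t *: x) = 2 * al * q.
      have aq0 : 0 <= 2 * al * q by apply: mulr_ge0 => //; apply: mulr_ge0.
      suff : enorm (x' - t *: x) ^+ 2 = (2 * al * q) ^+ 2.
        by move/eqP; rewrite eqrXn2 ?enorm_ge0 // => /eqP.
      rewrite sqr_enorm !dotE (dotC x' x) -/t xx1' xx1.
      have -> : (2 * al * q) ^+ 2 = 2 * (2 * al ^+ 2) * q ^+ 2.
        by clear; ring.
      have al2 : al ^+ 2 = (1 - t) / 2 by rewrite alE mulrC mulKf.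
      by rewrite qE al2; clear; field.
    by rewrite (_ : dot _ _ = D) // !dotE -/t -/z0 xx1 /D; clear; ring.
Qed.

(** * Volume of the color class *)

Section cells_volume.
Context {R : realType} {n : nat}.
Variable mu : {sigma_finite_measure set 'rV[R]_n.+1 -> \bar R}.
Hypotheses (muD : translation_invariant mu) (muB : box_formula mu).

(** The ball is covered by the preimages of the cells under the maps
    [axial_map], at most [1 / k + 1] of them for each cell. Each map multiplies
    volumes by [k * l ^+ n], and the cells themselves are disjoint. *)
Lemma shrunk_cells_volume (a b e k l A sg : R) (X : seq 'rV[R]_n.+1) :
  0 <= a -> 0 <= b -> 0 < e -> 0 < k -> 0 < l -> l < 1 -> 0 < A -> A <= 1 ->
  b + e + 3 * k <= Num.sqrt (1 - l ^+ 2 * sg ^+ 2) ->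
  (forall x, x \in X -> enorm x = 1) ->
  (forall x x', x \in X -> x' \in X -> x' != x -> 2 * A <= enorm (x - x') /\
    a + e + 3 * k <=
      A * (Num.sqrt (1 - l ^+ 2 * A ^+ 2) - l * Num.sqrt (1 - A ^+ 2))) ->
  uniq X -> (0 < size X)%N ->
  (forall z x, unit_ball z -> x \in X ->
    (forall x', x' \in X -> dot z x' <= dot z x) ->
    dot z z - dot z x ^+ 2 <= sg ^+ 2) ->
  ((k * l ^+ n / (Num.truncn k^-1).+1%:R)%:E * mu unit_ball <=
    mu (\bigcup_(x in [set` X]) shrunk_cell a b X e x))%E.
Proof.
move=> a0 b0 e0 k0 l0 l1 A0 A1 cap Xunit Xsep uX X0 Xcov.
set K := (Num.truncn k^-1).+1.
pose cell := shrunk_cell a b X e.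
have mcell x : measurable (cell x) by exact: measurable_shrunk_cell.
have kl0 : 0 < k * l ^+ n by rewrite mulr_gt0 // exprn_gt0.
have cellfin x : mu (cell x) \is a fin_num.
  rewrite ge0_fin_numE ?measure_ge0 //.
  apply: le_lt_trans (_ : mu unit_ball < +oo)%E; last first.
    by rewrite -ge0_fin_numE ?measure_ge0 // unit_ball_fin_num.
  apply: le_measure; rewrite ?inE //; first exact: measurable_unit_ball.
  by move=> w [].
have -> : mu (\bigcup_(x in [set` X]) cell x) = (\sum_(x <- X) mu (cell x))%E.
  rewrite measure_fin_bigcup //.
  - exact/esym/fsbig_seq.
  - exact: finite_seq.
  - move=> x x' /= xX xX' [w [wx wx']].
    by apply: (shrunk_cell_disjoint (a := a)) wx wx' => //; lra.
pose psi (p : 'rV[R]_n.+1 * 'I_K) :=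
  axial_map ((k * p.2%:R - k) *: p.1) p.1 k l.
pose s := [seq (x, i) | x <- X, i <- enum 'I_K].
have us : uniq s by apply: allpairs_uniq; rewrite ?enum_uniq // => -[? ?] [? ?].
have volume_psi p : p \in s ->
    mu [set z | cell p.1 (psi p z)] = ((k * l ^+ n)^-1%:E * mu (cell p.1))%E.
  move=> /allpairsP[[x i] /= [xX _ ->]]; apply: measure_axial_map => //.
  by rewrite -sqr_enorm Xunit ?expr1n.
have mpsi p : measurable [set z | cell p.1 (psi p z)].
  have mp : measurable_fun setT (psi p).
    apply: measurable_fun_rV => i.
    have -> : (fun z => psi p z 0 i) = (fun z : 'rV[R]_n.+1 =>
        ((k * p.2%:R - k) *: p.1) 0 i +
        (l * z 0 i + ((k - l) * dot z p.1) * p.1 0 i)).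
      by apply/funext => z; rewrite /psi /axial_map !mxE.
    apply: measurable_funD => //.
    apply: measurable_funD; apply: measurable_funM => //.
      exact: measurable_coord.
    by apply: measurable_funM => //; exact: measurable_dotr.
  by have := mp measurableT _ (mcell p.1); rewrite setTI.
have : (mu unit_ball <= \sum_(p <- s) mu [set z | cell p.1 (psi p z)])%E.
  rewrite fsbig_seq //; apply: content_sub_fsum => //.
    exact: measurable_unit_ball.
  move=> z zb; have [x xX znear] := seq_argmax (dot z) X0.
  have [i wi] := axial_map_shrunk_cell a0 b0 e0 k0 l0 l1 A0 A1 cap Xunit Xsep
    xX zb znear (Xcov _ _ zb xX znear).
  exists (x, i) => //=; apply/allpairsP; exists (x, i).
  by rewrite mem_enum.
rewrite big_seq (eq_bigr _ volume_psi) -big_seq.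
rewrite big_allpairs_dep /=.
have fE x : mu (cell x) = (fine (mu (cell x)))%:E by rewrite fineK.
under eq_bigr do under eq_bigr do rewrite fE -EFinM.
under [X in (_ -> _ <= X)%E]eq_bigr do rewrite fE.
under eq_bigr do rewrite big_enum sumEFin sumr_const card_ord.
rewrite !sumEFin; move: (unit_ball_fin_num muB); case: (mu unit_ball) => // r _.
rewrite -EFinM !lee_fin sumrMnl -mulr_sumr => h.
rewrite -ler_pdivlMl; last by rewrite divr_gt0 ?ltr0n.
apply: le_trans h _; by rewrite invf_div -[leLHS]mulr_natr [leLHS]mulrC mulrA.
Qed.

End cells_volume.

(** * Coloring the spheres of one radius *)

(** A separated set of maximal size; sizes are bounded because the points of a
    separated set lie in different cells of a fine net. *)
Lemma maximal_separated (R : realType) (n : nat) (co : R) : co < 1 ->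
  exists X : seq 'rV[R]_n.+1, [/\ uniq X, forall x, x \in X -> enorm x = 1,
    forall x x', x \in X -> x' \in X -> x' != x -> dot x x' < co &
    forall y, enorm y = 1 -> exists2 x, x \in X & co <= dot y x].
Proof.
move=> co1; have e0 : 0 < Num.sqrt (1 - co) by rewrite sqrtr_gt0 subr_gt0.
have [Q [q [_ qP]]] := @sphere_net R n.+1 _ e0.
pose sep (X : seq 'rV[R]_n.+1) := [/\ uniq X, forall x, x \in X -> enorm x = 1 &
  forall x x', x \in X -> x' \in X -> x' != x -> dot x x' < co].
have ex : exists m, `[< exists2 X, sep X & size X = m >].
  by exists 0%N; apply/asboolP; exists [::].
have ub m : `[< exists2 X, sep X & size X = m >] -> (m <= #|Q|)%N.
  move=> /asboolP[X [uX X1 Xs] <-]; rewrite -(size_map q).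
  suff /card_uniqP <- : uniq (map q X) by exact: max_card.
  rewrite map_inj_in_uniq // => x x' xX xX' /(qP _ _ (X1 _ xX) (X1 _ xX')) xx'.
  apply/eqP; apply: contraT => ne; rewrite eq_sym in ne.
  have : enorm (x - x') ^+ 2 <= Num.sqrt (1 - co) ^+ 2.
    by rewrite lerXn2r ?nnegrE ?enorm_ge0 ?sqrtr_ge0.
  have co0 : 0 <= 1 - co by rewrite subr_ge0 ltW.
  rewrite (sqr_sqrtr co0) sqr_enorm !dotE -!sqr_enorm !X1 // expr1n.
  by rewrite (dotC x' x); have := Xs _ _ xX xX' ne; lra.
case: (ex_maxnP ex ub) => m /asboolP[X [uX X1 Xs] Xm] mmax.
exists X; split => // y y1; apply: contrapT => noX.
have yX x : x \in X -> dot y x < co.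
  by move=> xX; rewrite ltNge; apply/negP => h; apply: noX; exists x.
suff : (m.+1 <= m)%N by rewrite ltnn.
apply: mmax; apply/asboolP; exists (y :: X); last by rewrite /= Xm.
have yy : dot y y = 1 by rewrite -sqr_enorm y1 expr1n.
split.
- by rewrite /= uX andbT; apply/negP => /yX; rewrite yy; lra.
- by move=> x; rewrite in_cons => /predU1P[->|/X1].
- move=> x x'; rewrite !in_cons => /predU1P[->|xX] /predU1P[->|xX'].
  + by rewrite eqxx.
  + by move=> _; exact: yX.
  + by move=> _; rewrite dotC; exact: yX.
  + exact: Xs.
Qed.

(** A color is the index of an isometry that brings the point, rescaled to the
    unit sphere, into [C]. *)
Lemma colorable_of_isometries (R : realType) (n : nat) (r : R)
    (C : set 'rV[R]_n.+1) (gs : seq 'M[R]_n.+1) : 0 < r ->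
  (forall g, g \in gs -> isometry_mx g) ->
  (forall y, enorm y = 1 -> exists2 g, g \in gs & C (y *m g)) ->
  (forall y y', enorm y = 1 -> enorm y' = 1 -> C y -> C y' ->
    enorm (y - y') <> r^-1) ->
  unit_distance_colorable (euclidean_sphere n r) (size gs).
Proof.
move=> r0 ogs cov free.
have unit u : euclidean_sphere n r u -> enorm (r^-1 *: u) = 1.
  by move=> ur; rewrite enormZ normfV gtr0_norm // ur mulVf // gt_eqF.
have idx (u : euclidean_sphere n r) : exists i : 'I_(size gs),
    C (r^-1 *: set_val u *m nth 1%:M gs i).
  have [g ggs Cg] := cov _ (unit _ (set_valP u)).
  have ilt : (index g gs < size gs)%N by rewrite index_mem.
  by exists (Ordinal ilt) => /=; rewrite nth_index.
exists (fun u => sval (cid (idx u))) => u v uv euv.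
have Cu := svalP (cid (idx u)); have Cv := svalP (cid (idx v)).
rewrite euv in Cu; move: Cu Cv; set i := sval _ => Cu Cv.
have og : isometry_mx (nth 1%:M gs i) by apply: ogs; exact: mem_nth.
have := free _ _ _ _ Cu Cv.
rewrite !enorm_isometry // !unit; try exact: set_valP.
move=> /(_ erefl erefl); apply.
rewrite -mulmxBl enorm_isometry // -scalerBr enormZ uv mulr1.
by rewrite gtr0_norm // invr_gt0.
Qed.

(** All constants are independent of the dimension: the color class has
    proportion at least a constant times [l ^+ n]. The parameter [sg] bounds the
    sine of the angular radius of the Voronoi cells of [X] from above, and
    [2 * A] the distances between the points of [X] from below. *)
Lemma sphere_colorable (R : realType) (r b l A sg : R) :
  let a := r^-1 / 2 in
  0 < r -> 0 <= b -> a ^+ 2 + b ^+ 2 = 1 -> 0 < l -> l < 1 -> 0 < A -> A <= 1 ->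
  b < Num.sqrt (1 - l ^+ 2 * sg ^+ 2) ->
  (forall n, exists X : seq 'rV[R]_n.+1, [/\ uniq X, (0 < size X)%N,
    forall x, x \in X -> enorm x = 1,
    forall x x', x \in X -> x' \in X -> x' != x -> 2 * A <= enorm (x - x') /\
      a < A * (Num.sqrt (1 - l ^+ 2 * A ^+ 2) - l * Num.sqrt (1 - A ^+ 2)) &
    forall z x, unit_ball z -> x \in X ->
      (forall x', x' \in X -> dot z x' <= dot z x) ->
      dot z z - dot z x ^+ 2 <= sg ^+ 2]) ->
  exists2 M : R, 0 < M & forall n, exists2 N : nat,
    N%:R <= M * n.+1%:R ^+ 2 / l ^+ n &
    unit_distance_colorable (euclidean_sphere n r) N.
Proof.
move=> a r0 b0 ab l0 l1 A0 A1 cap Xex.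
have a0 : 0 < a by rewrite divr_gt0 ?invr_gt0.
(* The second slack counts only if X has several points, which its hypothesis
   reveals by being positive. *)
pose m1 := Num.sqrt (1 - l ^+ 2 * sg ^+ 2) - b.
pose m2 := A * (Num.sqrt (1 - l ^+ 2 * A ^+ 2) - l * Num.sqrt (1 - A ^+ 2)) - a.
pose m := if 0 < m2 then Num.min m1 m2 else m1.
have m10 : 0 < m1 by rewrite subr_gt0.
have m0 : 0 < m by rewrite /m; case: ifP => // m20; rewrite lt_min m10.
have mm1 : m <= m1 by rewrite /m; case: ifP => // _; rewrite ge_min lexx.
have mm2 : 0 < m2 -> m <= m2 by rewrite /m => ->; rewrite ge_min lexx orbT.
have m11 : m1 <= 1.
  rewrite lerBlDr (le_trans _ (_ : 1 <= 1 + b)) ?lerDl // -sqrtr1.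
  by apply: ler_wsqrtr; rewrite sqrtr1 gerBl mulr_ge0 // sqr_ge0.
(* Both the margin of the cells and the height step are k, and the slack must
   absorb the former once and the latter three times. *)
pose k := m / 4; have k0 : 0 < k by rewrite divr_gt0.
pose K := (Num.truncn k^-1).+1.
have K0 : 0 < K%:R :> R by rewrite ltr0n.
have k1 : k <= 1 by rewrite /k; lra.
exists (8 * K%:R / k ^+ 2 + 1).
  by rewrite addr_gt0 // divr_gt0 ?exprn_gt0 // mulr_gt0.
move=> n; have [X [uX X0 X1 Xs Xcov]] := Xex n.
have ln0 : 0 < l ^+ n by rewrite exprn_gt0.
have ln1 : l ^+ n <= 1 by rewrite exprn_ile1 // ltW.
pose p := k * l ^+ n / K%:R.
have p0 : 0 < p by rewrite divr_gt0 // mulr_gt0.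
have p1 : p <= 1.
  rewrite ler_pdivrMr // mul1r (le_trans (_ : _ <= 1)) ?ler1n //.
  by rewrite mulr_ile1 // ltW.
have [mu [muD muB]] := exists_volume R n.+1.
pose W := \bigcup_(x in [set` X]) shrunk_cell a b X k x.
have Wvol : (p%:E * mu unit_ball <= mu W)%E.
  apply: (@shrunk_cells_volume R n mu muD muB a b k k l A sg X) => //;
    try exact: ltW.
  - by move: mm1; rewrite /m1 /k; lra.
  - move=> x x' xX xX' xx'; have [h1 h2] := Xs x x' xX xX' xx'; split=> //.
    by have : m <= m2 by [apply: mm2; rewrite /m2; lra]; rewrite /m2 /k; lra.
have mW : measurable W.
  apply: fin_bigcup_measurable => [|x _]; first exact: finite_seq.
  exact: measurable_shrunk_cell.
pose s := k / 2; have s0 : 0 < s by rewrite divr_gt0.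
pose N := (Num.truncn (4 * n.+1%:R ^+ 2 / s / p)).+1.
exists N.
  have x0 : 0 <= 4 * n.+1%:R ^+ 2 / s / p.
    by rewrite !mulr_ge0 ?invr_ge0 ?(ltW s0) ?(ltW p0) // exprn_ge0.
  rewrite /N -natr1; apply: le_trans (_ : 4 * n.+1%:R ^+ 2 / s / p + 1 <= _).
    by rewrite lerD2r truncn_le.
  have -> : (8 * K%:R / k ^+ 2 + 1) * n.+1%:R ^+ 2 / l ^+ n =
      8 * K%:R / k ^+ 2 * n.+1%:R ^+ 2 / l ^+ n + n.+1%:R ^+ 2 / l ^+ n by ring.
  apply: lerD.
    rewrite le_eqVlt; apply/orP; left; apply/eqP; rewrite /p /s; field.
    by rewrite !gt_eqF.
  rewrite ler_pdivlMr // mul1r (le_trans ln1) // exprn_ege1 // ler1n //.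
have Np : 4 * n.+1%:R ^+ 2 / s < p * N%:R.
  by rewrite [ltRHS]mulrC -ltr_pdivrMr // /N; exact: truncnS_gt.
have [|w [x _ wx]|gs [gsN ogs gsP]] :=
  covering_by_isometries muD muB mW _ _ p0 p1 Wvol s0 Np.
- by move=> w [x _ []].
- by apply: shrunk_cell_neq0 wx; lra.
rewrite -gsN; apply: (@colorable_of_isometries R n r (color_class a b X)) => //.
- move=> y /gsP[g ggs [w [x xX wx] near]]; exists g => //.
  apply: (shrunk_cell_near X1 (ltW a0) b0 k0 xX wx).
  by move: near; rewrite /s -[X in _ < X]mulr_natr divfK.
- move=> y y' y1 y1' Cy Cy'.
  have -> : r^-1 = 2 * a by rewrite /a; field; rewrite gt_eqF.
  exact: (color_class_free X1 (ltW a0) b0 ab).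
Qed.

(** One point [X], whose cell is the whole sphere: the color class is a cap of
    radius slightly below [a]. *)
Lemma small_sphere_colorable (R : realType) (r l : R) : 1 / 2 < r ->
  0 < l -> l * (2 * r) < 1 ->
  exists2 M : R, 0 < M & forall n, exists2 N : nat,
    N%:R <= M * n.+1%:R ^+ 2 / l ^+ n &
    unit_distance_colorable (euclidean_sphere n r) N.
Proof.
move=> hr l0 lr; have r0 : 0 < r by lra.
pose a := r^-1 / 2.
have aE : a * (2 * r) = 1 by rewrite /a; field; rewrite gt_eqF.
have r20 : 0 < 2 * r by lra.
have la : l < a by rewrite -(ltr_pM2r r20) aE.
have a1 : a < 1 by rewrite -(ltr_pM2r r20) aE; lra.
have a21 : a ^+ 2 < 1 by rewrite expr_lt1 //; lra.
have la2 : l ^+ 2 < a ^+ 2 by rewrite ltrXn2r ?nnegrE //; lra.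
have bE : Num.sqrt (1 - a ^+ 2) ^+ 2 = 1 - a ^+ 2 by rewrite sqr_sqrtr //; lra.
apply: (@sphere_colorable R r (Num.sqrt (1 - a ^+ 2)) l 1 1) => //.
- by rewrite -/a bE; ring.
- by lra.
- by rewrite expr1n mulr1 ltr_sqrt; lra.
move=> n; exists [:: delta_mx 0 0]; split => // [x|x x'|z x zb].
- by rewrite inE => /eqP ->; exact: enorm_delta.
- by rewrite !inE => /eqP -> /eqP ->; rewrite eqxx.
- move=> _ _; rewrite expr1n; have := sqr_ge0 (dot z x).
  have : dot z z <= 1 := zb; lra.
Qed.

(** Here [co] is the cosine of the sum of the two angles whose sines are [a] and
    [2 * a], and any two points of [X] form an angle at least as large. *)
Lemma large_sphere_colorable (R : realType) (r l : R) (a := r^-1 / 2)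
    (co := Num.sqrt (1 - 5 * a ^+ 2 + 4 * a ^+ 4) - 2 * a ^+ 2) :
  0 < r -> 5 * a ^+ 2 < 1 -> 0 < l -> l * Num.sqrt (5 + 4 * co) < 1 ->
  exists2 M : R, 0 < M & forall n, exists2 N : nat,
    N%:R <= M * n.+1%:R ^+ 2 / l ^+ n &
    unit_distance_colorable (euclidean_sphere n r) N.
Proof.
move=> r0 a5 l0 lx.
have a0 : 0 < a by rewrite /a divr_gt0 ?invr_gt0.
have a20 : 0 < a ^+ 2 by rewrite exprn_gt0.
have a4E : a ^+ 4 = a ^+ 2 * a ^+ 2 by ring.
have a40 : 0 < a ^+ 4 by rewrite exprn_gt0.
have ltr2 (u v : R) : 0 <= v -> u ^+ 2 < v ^+ 2 -> u < v.
  move=> v0; have [u0|u0] := leP 0 u; first by rewrite ltr_pXn2r ?nnegrE.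
  by move=> _; rewrite (lt_le_trans u0).
pose P := Num.sqrt (1 - 5 * a ^+ 2 + 4 * a ^+ 4).
have P0 : 0 <= P by exact: sqrtr_ge0.
have PE : P ^+ 2 = 1 - 5 * a ^+ 2 + 4 * a ^+ 4 by rewrite sqr_sqrtr //; lra.
have coE : co = P - 2 * a ^+ 2 by [].
have co0 : 0 < co.
  rewrite coE subr_gt0; apply: ltr2 => //; rewrite PE.
  by rewrite (_ : (2 * a ^+ 2) ^+ 2 = 4 * a ^+ 4); [lra|ring].
have P1 : P < 1.
  apply: ltr2 => //; rewrite PE expr1n a4E.
  have : a ^+ 2 * a ^+ 2 < a ^+ 2 * 1 by rewrite ltr_pM2l //; lra.
  lra.
have co1 : co < 1 by rewrite coE; lra.
pose x0 := Num.sqrt (5 + 4 * co).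
have x0E : x0 ^+ 2 = 5 + 4 * co by rewrite sqr_sqrtr //; lra.
have x00 : 0 < x0 by rewrite sqrtr_gt0; lra.
have lx2 : l ^+ 2 * (5 + 4 * co) < 1.
  rewrite -x0E -exprMn expr_lt1 //; first by rewrite ltW // mulr_gt0.
have l1 : l < 1.
  apply: ltr2 => //; rewrite expr1n; apply: le_lt_trans lx2.
  by rewrite ler_peMr ?sqr_ge0 //; lra.
(* The sine of the angle whose cosine is co is a * x0. *)
have sgE : 1 - co ^+ 2 = a ^+ 2 * (5 + 4 * co).
  have -> : 1 - co ^+ 2 = 1 - P ^+ 2 + 4 * a ^+ 2 * P - 4 * a ^+ 4.
    by rewrite coE; ring.
  by rewrite PE coE; ring.
pose A := Num.sqrt ((1 - co) / 2); pose Q := Num.sqrt (1 - A ^+ 2).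
have A0 : 0 < A by rewrite sqrtr_gt0; lra.
have AE : A ^+ 2 = (1 - co) / 2 by rewrite sqr_sqrtr //; lra.
have A1 : A <= 1 by rewrite ltW //; apply: ltr2 => //; rewrite AE expr1n; lra.
have Q0 : 0 <= Q by exact: sqrtr_ge0.
have QE : Q ^+ 2 = (1 + co) / 2 by rewrite sqr_sqrtr AE; lra.
have l20 : 0 < l ^+ 2 by rewrite exprn_gt0.
have sep : a < A * (Num.sqrt (1 - l ^+ 2 * A ^+ 2) - l * Q).
  have l21 : l ^+ 2 < 1 by rewrite expr_lt1 // ltW.
  have lA : l ^+ 2 * A ^+ 2 <= l ^+ 2 * 1.
    by rewrite ler_pM2l // expr_le1 // ltW.
  pose C := Num.sqrt (1 - l ^+ 2 * A ^+ 2).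
  have CE : C ^+ 2 = 1 - l ^+ 2 * A ^+ 2 by rewrite sqr_sqrtr //; lra.
  have C0 : 0 <= C by exact: sqrtr_ge0.
  (* For l = 1 / x0 this inequality and the next are equalities. *)
  have h1 : 3 / 2 * a < A * C.
    apply: ltr2; first by rewrite mulr_ge0 // ltW.
    have -> : (3 / 2 * a) ^+ 2 = 9 / 4 * (1 - co ^+ 2) / (5 + 4 * co).
      by rewrite sgE; field; rewrite gt_eqF //; lra.
    rewrite exprMn CE AE ltr_pdivrMr; last by lra.
    have : l ^+ 2 * (5 + 4 * co) * ((1 - co) ^+ 2 / 4) <
        1 * ((1 - co) ^+ 2 / 4).
      by rewrite ltr_pM2r // divr_gt0 // exprn_gt0 // subr_gt0.
    by lra.
  have h2 : l * (A * Q) < a / 2.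
    apply: ltr2; first by rewrite ltW // divr_gt0.
    have -> : (l * (A * Q)) ^+ 2 = l ^+ 2 * ((1 - co ^+ 2) / 4).
      by rewrite !exprMn AE QE; field.
    have -> : (a / 2) ^+ 2 = a ^+ 2 / 4 by field.
    rewrite sgE.
    have : a ^+ 2 * (l ^+ 2 * (5 + 4 * co)) < a ^+ 2 * 1 by rewrite ltr_pM2l.
    by lra.
  rewrite -/C; lra.
pose b := Num.sqrt (1 - a ^+ 2).
have bE : b ^+ 2 = 1 - a ^+ 2 by rewrite sqr_sqrtr //; lra.
pose sg := Num.sqrt (1 - co ^+ 2).
have co21 : co ^+ 2 < 1 by rewrite expr_lt1 // ltW.
have sg2 : sg ^+ 2 = 1 - co ^+ 2 by rewrite sqr_sqrtr // subr_ge0 ltW.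
apply: (@sphere_colorable R r b l A sg) => //.
- exact: sqrtr_ge0.
- by rewrite -/a bE; ring.
- rewrite sg2 sgE /b ltr_sqrt.
    rewrite ltrD2l ltrN2 mulrCA -[ltRHS]mulr1 ltr_pM2l //.
  have : a ^+ 2 * (l ^+ 2 * (5 + 4 * co)) < a ^+ 2 * 1 by rewrite ltr_pM2l.
  lra.
move=> n; have [X [uX X1 Xs Xcov]] := @maximal_separated R n co co1.
exists X; split => //.
- by have [x xX _] := Xcov _ (@enorm_delta R n.+1 0); case: (X) xX.
- move=> x x' xX xX' xx'; split=> //.
  rewrite -(@ler_pXn2r _ 2) ?nnegrE ?enorm_ge0 ?mulr_ge0 ?(ltW A0) //.
  rewrite exprMn AE sqr_enorm !dotE -!sqr_enorm !X1 // (dotC x' x).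
  by have := Xs _ _ xX xX' xx'; lra.
move=> z x zb xX znear; rewrite sg2.
have zz : dot z z <= 1 := zb.
have [z0|z0] := eqVneq z 0; first by rewrite z0 !dot0l expr0n /= subr0; lra.
have nz : 0 < enorm z by rewrite lt_def enorm_eq0 z0 enorm_ge0.
have [|x1 x1X] := Xcov ((enorm z)^-1 *: z).
  by rewrite enormZ normfV gtr0_norm // mulVf // gt_eqF.
rewrite dotZl ler_pdivlMl // => h.
have h' : enorm z * co <= dot z x by apply: le_trans h (znear _ x1X).
have : (enorm z * co) ^+ 2 <= dot z x ^+ 2.
  by rewrite lerXn2r ?nnegrE // ?(le_trans _ h') // mulr_ge0 // ltW.
rewrite exprMn sqr_enorm => h2.
have : dot z z * (1 - co ^+ 2) <= 1 * (1 - co ^+ 2).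
  by rewrite ler_wpM2r // subr_ge0 ltW.
lra.
Qed.

Lemma sphere_colorable_base (R : realType) (r l : R) : 1 / 2 < r ->
  0 < l -> l * sphere_coloring_base r < 1 ->
  exists2 M : R, 0 < M & forall n, exists2 N : nat,
    N%:R <= M * n.+1%:R ^+ 2 / l ^+ n &
    unit_distance_colorable (euclidean_sphere n r) N.
Proof.
move=> hr l0; rewrite /sphere_coloring_base.
case: ifP => [r5|_] lx; last exact: small_sphere_colorable lx.
have r0 : 0 < r by lra.
pose a := r^-1 / 2.
have aE : a ^+ 2 = (4 * r ^+ 2)^-1 by rewrite /a; field; rewrite gt_eqF.
have a4E : a ^+ 4 = (16 * r ^+ 4)^-1 by rewrite /a; field; rewrite gt_eqF.
have r25 : 5 / 4 < r ^+ 2.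
  have -> : 5 / 4 = (Num.sqrt 5 / 2) ^+ 2 :> R.
    by rewrite expr_div_n sqr_sqrtr //; field.
  by rewrite ltrXn2r ?nnegrE ?divr_ge0 ?sqrtr_ge0 // ltW.
apply: large_sphere_colorable => //.
  by rewrite -/a aE ltr_pdivrMr ?mulr_gt0 ?exprn_gt0 // mul1r; lra.
rewrite -/a; move: lx; congr (_ * Num.sqrt _ < _).
have -> : 1 - 5 * a ^+ 2 + 4 * a ^+ 4 = 1 - (5 * r ^+ 2 - 1) / (4 * r ^+ 4).
  by rewrite aE a4E; field; rewrite gt_eqF.
by rewrite aE; field; rewrite gt_eqF.
Qed.

(** * Asymptotics *)

(** Compare with the cubic term of the exponential series. *)
Lemma quadratic_le_exponential (R : realType) (M q : R) : 0 < M -> 1 < q ->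
  exists n0 : nat, forall n, (n0 <= n)%N -> M * n.+1%:R ^+ 2 <= q ^+ n.
Proof.
move=> M0 q1; pose c := ln q; have c0 : 0 < c by rewrite ln_gt0.
have c30 : 0 < c ^+ 3 by rewrite exprn_gt0.
pose n0 := (Num.truncn (24 * M / c ^+ 3)).+1.
exists n0 => n n0n.
have n1 : 1 <= n%:R :> R by rewrite ler1n (leq_trans _ n0n).
have nM : 24 * M <= c ^+ 3 * n%:R.
  rewrite [leRHS]mulrC -ler_pdivrMr //.
  by apply/ltW/(lt_le_trans (truncnS_gt _)); rewrite ler_nat.
have -> : q ^+ n = expR (n%:R * c) by rewrite expRM_natl lnK // posrE; lra.
have nc0 : 0 <= n%:R * c by rewrite mulr_ge0 ?ler0n // ltW.
apply: le_trans (expR_ge1Dxn 2 nc0); rewrite (_ : 3`! = 6)%N //.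
apply: le_trans (_ : 4 * M * n%:R ^+ 2 <= _).
  have : n.+1%:R ^+ 2 <= (2 * n%:R) ^+ 2 :> R.
    by rewrite lerXn2r ?nnegrE ?ler0n ?mulr_ge0 // -natr1; lra.
  rewrite exprMn => /(ler_wpM2l (ltW M0)); lra.
have := ler_wpM2r (exprn_ge0 2 (ler0n R n)) nM.
have -> : c ^+ 3 * n%:R * n%:R ^+ 2 = (n%:R * c) ^+ 3 by ring.
lra.
Qed.

Lemma chromatic_number_le (R : realType) (d : nat) (A : set 'rV[R]_d)
    (k : nat) : unit_distance_colorable A k ->
  (chromatic_number A <= k%:R%:E)%E.
Proof. by move=> Ak; apply: ereal_inf_lbound; exists k. Qed.

Lemma chromatic_number_ge0 (R : realType) (d : nat) (A : set 'rV[R]_d) :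
  (0 <= chromatic_number A)%E.
Proof. by apply: le_ereal_inf_tmp => _ [k _ <-]; rewrite lee_fin. Qed.

(** The two points of the sphere are at distance [2 * r], which is not one. *)
Lemma sphere0_colorable (R : realType) (r : R) : 1 / 2 < r ->
  unit_distance_colorable (euclidean_sphere 0 r) 1.
Proof.
move=> hr; exists (fun=> ord0) => u v.
set x := set_val u; set y := set_val v => uv.
have norm1 (w : 'rV[R]_1) : enorm w = `|w 0 0|.
  by rewrite /euclidean_norm big_ord1 sqrtr_sqr.
have ux : `|x 0 0| = r by rewrite -norm1; exact: (set_valP u).
have vy : `|y 0 0| = r by rewrite -norm1; exact: (set_valP v).
move: uv; rewrite norm1 !mxE; move: (x 0 0) (y 0 0) ux vy => p q up vq.
suff : `|p - q| = 1 -> False by move=> h /h.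
by move: up vq; case: (ger0P p) => _ pr; case: (ger0P q) => _ qr;
  case: ger0P => _ pq; lra.
Qed.

Lemma sphere_coloring_base_ge0 (R : realType) (r : R) : 1 / 2 < r ->
  0 <= sphere_coloring_base r.
Proof.
move=> hr; rewrite /sphere_coloring_base.
by case: ifP => _; [exact: sqrtr_ge0|lra].
Qed.

Theorem theorem1 (R : realType) (r : R) (hr : 1 / 2 < r) :
  exists eps : nat -> R,
    (eps @ \oo --> (0 : R)) /\
    forall n : nat,
      (chromatic_number (euclidean_sphere n r) <=
         ((sphere_coloring_base r + eps n) ^+ n)%R%:E)%E.
Proof.
set x := sphere_coloring_base r.
have x0 : 0 <= x by exact: sphere_coloring_base_ge0.
pose chi n := chromatic_number (euclidean_sphere n r).
have chi0 n : (0 <= chi n)%E by exact: chromatic_number_ge0.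
have growth y : x < y -> exists2 M : R, 0 < M & forall n,
    (chi n <= (M * n.+1%:R ^+ 2 * y ^+ n)%:E)%E.
  move=> xy; have y0 : 0 < y by exact: le_lt_trans xy.
  have [||M M0 MP] := @sphere_colorable_base R r y^-1 hr.
    by rewrite invr_gt0.
    by rewrite mulrC ltr_pdivrMr ?mul1r.
  exists M => // n; have [N NM /chromatic_number_le chiN] := MP n.
  by apply: le_trans chiN _; rewrite lee_fin; move: NM; rewrite exprVn invrK.
have [M1 _ M1P] := growth (x + 1) ltac:(lra).
have chi_fin n : chi n \is a fin_num.
  by rewrite ge0_fin_numE // (le_lt_trans (M1P n)) // ltry.
pose root n := fine (chi n) `^ n%:R^-1.
have root0 n : 0 <= root n by exact: powR_ge0.
have rootK n : (0 < n)%N -> root n ^+ n = fine (chi n).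
  move=> n0; rewrite -powR_mulrn // /root -powRrM mulVf ?powRr1 ?fine_ge0 //.
  by rewrite pnatr_eq0 -lt0n.
(* The root may stay below x; only its excess over x has to tend to 0. *)
exists (fun n => Num.max 0 (root n - x)); split; last first.
  case=> [|n]; first exact: chromatic_number_le (sphere0_colorable hr).
  rewrite -/(chi _) -(fineK (chi_fin _)) lee_fin -rootK //.
  have h : root n.+1 <= x + Num.max 0 (root n.+1 - x).
    by rewrite -lerBlDl le_max lexx orbT.
  by rewrite lerXn2r ?nnegrE // (le_trans _ h).
apply/cvgrPdist_le => e e0.
have xe2 : 0 < x + e / 2 by lra.
have [M M0 MP] := growth (x + e / 2) ltac:(lra).
have q1 : 1 < (x + e) / (x + e / 2) by rewrite ltr_pdivlMr // mul1r; lra.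
have [n0 n0P] := quadratic_le_exponential M0 q1.
exists n0.+1 => // n /= n0n; have npos : (0 < n)%N by exact: leq_trans n0n.
rewrite sub0r normrN ger0_norm ?le_max ?lexx // ge_max (ltW e0) /= lerBlDl.
have xe : 0 <= x + e by lra.
rewrite -(@ler_pXn2r _ n) ?nnegrE // rootK // -lee_fin fineK //.
apply: le_trans (MP n) _; rewrite lee_fin.
apply: le_trans (_ : ((x + e) / (x + e / 2)) ^+ n * (x + e / 2) ^+ n <= _).
  by rewrite ler_wpM2r ?exprn_ge0 ?(ltW xe2) // n0P // ltnW.
by rewrite -exprMn divfK // gt_eqF.
Qed.
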